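(* Let $S$ be a spray on a manifold $M$, let $P$ be a (positively) 1-homogeneous function, and let $\tilde S = S - 2P\Delta$ be the corresponding projectively related spray. Then the conjugate points of $S$ are preserved under the projective change, in the following sense. Let $c: I\to M$ be a geodesic of $S$ with $0\in I$, and let $\tilde c = c\circ\theta:\tilde I\to M$ be a geodesic of $\tilde S$, where $\tilde I$ is an open interval containing $0$ and $\theta:\tilde I\to I$ is a parameter transformation (a diffeomorphism onto $I$) with strictly positive derivative and $\theta(0)=0$. Let $s_1\in\tilde I$, $s_1\neq 0$, and $t_1=\theta(s_1)$. If $c(t_1)$ is a conjugate point of $c(0)$ along $c$ (with respect to $S$, at parameter value $t_1$), then $\tilde c(s_1)=c(t_1)$ is a conjugate point of $\tilde c(0)=c(0)$ along $\tilde c$ (with respect to $\tilde S$, at parameter value $s_1$).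
   Context: $M$ is a smooth manifold with natural coordinates $(x^i,\dot x^i)$ on $TM$. A second-order differential equation field (SODE) is a vector field $S=\dot x^i\frac{\partial}{\partial x^i}+f^i(x,\dot x)\frac{\partial}{\partial\dot x^i}$; its base integral curves $c$ are the curves in $M$ with $\ddot c(t)=S(\dot c(t))$, i.e. $\ddot x^i=f^i(x,\dot x)$. Let $\Delta=\dot x^i\frac{\partial}{\partial \dot x^i}$ be the Liouville vector field. A SODE $S$ is a spray if $[\Delta,S]=S$, equivalently $f^i(x,\lambda\dot x)=\lambda^2f^i(x,\dot x)$ for all $\lambda>0$. Base integral curves of a spray are called geodesics. Sprays and projective factors $P$ are assumed smooth on the slit tangent bundle $T^\circ M$ (the tangent bundle without its zero section); geodesics are thus regular curves on open intervals. A function $P$ is positively 1-homogeneous if $P(\lambda v)=\lambda P(v)$ for $\lambda>0$. A spray $\tilde S$ is projectively related to $S$ if $\tilde S=S-2P\Delta$ for some 1-homogeneous $P$. (Each geodesic of $S$ can be reparametrized, with strictly positive derivative, to a geodesic of $\tilde S$.) For a SODE put $\Gamma^i_j=-\frac12\frac{\partial f^i}{\partial\dot x^j}$ and $\Phi^i_j=-\frac{\partial f^i}{\partial x^j}-\Gamma^k_j\Gamma^i_k-S(\Gamma^i_j)$. Along a base integral curve $c$, for a vector field $W(t)=W^i(t)\frac{\partial}{\partial x^i}|_{c(t)}$ along $c$, define $\nabla_cW=\big(\dot W^i+\Gamma^i_j(\dot c(t))W^j\big)\frac{\partial}{\partial x^i}|_{c(t)}$ and $\Phi_c(W)=\Phi^i_j(\dot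 c(t))W^j\frac{\partial}{\partial x^i}|_{c(t)}$. A Jacobi field along $c$ is a vector field $J(t)$ along $c$ with $\nabla_c\nabla_cJ+\Phi_c(J)=0$ (equivalently, the complete lift of $J$ is a variational vector field along $\dot c$ by integral curves of $S$). The point $c(t_1)$, $t_1\ne0$, is a conjugate point of $c(0)$ along $c$ if there is a Jacobi field $J$ along $c$, not identically zero, with $J(0)=J(t_1)=0$. *)

(* Defs.v *)
From HB Require Import structures.
From mathcomp Require Import all_boot all_order all_algebra.
From mathcomp Require Import all_classical all_reals all_analysis.

Set Implicit Arguments.
Unset Strict Implicit.
Unset Printing Implicit Defensive.

Import Order.TTheory GRing.Theory Num.Theory.
Import numFieldNormedType.Exports.

#[global] Open Scope ring_scope.
#[global] Open Scope classical_set_scope.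

(* C^infinity on U (meant for U open and E finite dimensional): every iterated
   directional derivative of f, including f itself (s = [::]), is Frechet
   differentiable at every point of U. *)
Definition smooth_on (R : realType) (E F : normedModType R)
    (U : set E) (f : E -> F) : Prop :=
  forall (s : seq E) (x : E), U x ->
    differentiable (foldr (fun (v : E) (g : E -> F) => 'D_v g) f s) x.

Definition diffeomorphism (R : realType) (A B : set R) (f : R -> R) : Prop :=
  exists g : R -> R,
    [/\ set_fun A B f, set_fun B A g,
        (forall s, A s -> g (f s) = s) & (forall t, B t -> f (g t) = t)]
    /\ (smooth_on A f /\ smooth_on B g).

(* [coord] and [icoord] are total functions that matter only on [dom] and on
   its image. *)
Record chart (R : realType) (n : nat) (M : topologicalType) := Chart {
  dom : set M;
  coord : M -> 'rV[R]_n;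
  icoord : 'rV[R]_n -> M;
  open_dom : open dom;
  open_image : open (coord @` dom);
  coordK : forall p, dom p -> icoord (coord p) = p;
  coord_continuous : {within dom, continuous coord};
  icoord_continuous : {within coord @` dom, continuous icoord} }.

Definition overlap (R : realType) (n : nat) (M : topologicalType)
    (a b : chart R n M) : set 'rV[R]_n :=
  coord a @` (dom a `&` dom b).

Definition transition (R : realType) (n : nat) (M : topologicalType)
    (a b : chart R n M) : 'rV[R]_n -> 'rV[R]_n :=
  coord b \o icoord a.

(* Smooth n-manifold, given by a (not necessarily maximal) smooth atlas. *)
Record smooth_manifold (R : realType) (n : nat) := SmoothManifold {
  carrier :> topologicalType;
  carrier_hausdorff : hausdorff_space carrier;
  carrier_second_countable : @second_countable carrier;
  atlas_index : Type;
  atlas : atlas_index -> chart R n carrier;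
  atlas_cover : forall p : carrier, exists a, dom (atlas a) p;
  atlas_smooth : forall a b,
    smooth_on (overlap (atlas a) (atlas b)) (transition (atlas a) (atlas b)) }.

Section SlitTangentBundle.
Context (R : realType) (n : nat) (M : smooth_manifold R n).

Local Notation V := 'rV[R]_n.
Local Notation chi := (@atlas R n M).

(* The slit tangent bundle in the natural coordinates (x, xdot) of a chart. *)
Definition slit (a : atlas_index M) : set (V * V) :=
  [set z | (coord (chi a) @` dom (chi a)) z.1 /\ z.2 != 0].

Definition slit_overlap (a b : atlas_index M) : set (V * V) :=
  [set z | overlap (chi a) (chi b) z.1 /\ z.2 != 0].

Definition ttransition (a b : atlas_index M) (z : V * V) : V * V :=
  (transition (chi a) (chi b) z.1,
   'd (transition (chi a) (chi b)) (z.1) z.2).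

(* Smooth functions and vector fields on the slit tangent bundle are
   represented by the family of their expressions in natural coordinates; the
   values outside [slit a] are irrelevant. *)
Definition slit_function := atlas_index M -> V * V -> R.
Definition slit_field := atlas_index M -> V * V -> V * V.

Definition smooth_slit_function (P : slit_function) : Prop :=
  (forall a, smooth_on (slit a) (P a)) /\
  (forall a b z, slit_overlap a b z -> P b (ttransition a b z) = P a z).

Definition smooth_slit_field (X : slit_field) : Prop :=
  (forall a, smooth_on (slit a) (X a)) /\
  (forall a b z, slit_overlap a b z ->
     X b (ttransition a b z) = 'd (ttransition a b) z (X a z)).

Definition pos_homogeneous1 (P : slit_function) : Prop :=
  forall a z (l : R), slit a z -> 0 < l -> P a (z.1, l *: z.2) = l * P a z.

Definition liouville : slit_field := fun _ z => (0, z.2).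

Definition lie_bracket (X Y : slit_field) : slit_field :=
  fun a z => 'd (Y a) z (X a z) - 'd (X a) z (Y a z).

Definition is_sode (S : slit_field) : Prop :=
  smooth_slit_field S /\ (forall a z, slit a z -> (S a z).1 = z.2).

Definition is_spray (S : slit_field) : Prop :=
  is_sode S /\
  (forall a z, slit a z -> lie_bracket liouville S a z = S a z).

(* S - 2 P Delta *)
Definition projective_change (S : slit_field) (P : slit_function) : slit_field :=
  fun a z => S a z - (2 * P a z) *: liouville a z.

(* f^i, for S = xdot^i d/dx^i + f^i d/dxdot^i *)
Definition force (S : slit_field) (a : atlas_index M) (i : 'I_n)
    (z : V * V) : R := (S a z).2 0 i.

Definition Gamma (S : slit_field) (a : atlas_index M) (i j : 'I_n)
    (z : V * V) : R :=
  - 2^-1 * 'D_((0, delta_mx 0 j) : V * V) (force S a i) z.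

Definition Phi (S : slit_field) (a : atlas_index M) (i j : 'I_n)
    (z : V * V) : R :=
  - 'D_((delta_mx 0 j, 0) : V * V) (force S a i) z
  - \sum_(k < n) Gamma S a k j z * Gamma S a i k z
  - 'D_(S a z) (Gamma S a i j) z.

(* Curves and vector fields along them are total in the parameter t, but only
   the values for t in the open interval I (and, for local expressions in the
   chart a, with c t in the domain of a) are meaningful. *)
Definition open_interval (I : set R) : Prop := open I /\ is_interval I.

Definition in_chart (I : set R) (c : R -> M) (a : atlas_index M) : set R :=
  [set t | I t /\ dom (chi a) (c t)].

Definition local_curve (c : R -> M) (a : atlas_index M) : R -> V :=
  fun t => coord (chi a) (c t).

Definition velocity (c : R -> M) (a : atlas_index M) : R -> V * V :=
  fun t => (local_curve c a t, (local_curve c a)^`() t).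

Definition regular_curve (I : set R) (c : R -> M) : Prop :=
  (forall t, I t -> {for t, continuous c}) /\
  (forall a, smooth_on (in_chart I c a) (local_curve c a)) /\
  (forall a t, in_chart I c a t -> (local_curve c a)^`() t != 0).

Definition is_geodesic (S : slit_field) (I : set R) (c : R -> M) : Prop :=
  [/\ open_interval I, regular_curve I c &
      forall a t, in_chart I c a t ->
        (velocity c a)^`() t = S a (velocity c a t)].

Definition curve_field := atlas_index M -> R -> V.

Definition smooth_curve_field (I : set R) (c : R -> M) (W : curve_field) : Prop :=
  (forall a, smooth_on (in_chart I c a) (W a)) /\
  (forall a b t, in_chart I c a t -> in_chart I c b t ->
     W b t = 'd (transition (chi a) (chi b)) (local_curve c a t) (W a t)).

Definition nabla (S : slit_field) (c : R -> M) (W : curve_field) : curve_field :=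
  fun a t => \row_(i < n)
    (derive1 (W a) t 0 i +
     \sum_(j < n) Gamma S a i j (velocity c a t) * W a t 0 j).

Definition Phi_along (S : slit_field) (c : R -> M) (W : curve_field)
    : curve_field :=
  fun a t => \row_(i < n)
    \sum_(j < n) Phi S a i j (velocity c a t) * W a t 0 j.

Definition is_jacobi_field (S : slit_field) (I : set R) (c : R -> M)
    (J : curve_field) : Prop :=
  smooth_curve_field I c J /\
  (forall a t, in_chart I c a t ->
     nabla S c (nabla S c J) a t + Phi_along S c J a t = 0).

Definition vanishes_at (I : set R) (c : R -> M) (J : curve_field) (t : R) : Prop :=
  forall a, in_chart I c a t -> J a t = 0.

(* c t1 is a conjugate point of c 0 along c : I -> M, at parameter value t1. *)
Definition conjugate_at (S : slit_field) (I : set R) (c : R -> M) (t1 : R) : Prop :=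
  [/\ I 0, I t1, t1 != 0 &
      exists J : curve_field,
        [/\ is_jacobi_field S I c J,
            (exists2 t, I t & ~ vanishes_at I c J t),
            vanishes_at I c J 0 & vanishes_at I c J t1]].

End SlitTangentBundle.

(* Main.v *)
(** Along a geodesic, a field J is a Jacobi field iff in every chart it solves
    the linearised geodesic equation (J^i)'' = df^i(J, J').  Let y be the
    velocity of c' = c o theta, and K = J o theta.  The geodesic equations of c
    and c' give theta'' = - 2 P(y) theta', and homogeneity then shows that K
    misses the linearised equation of S - 2 P Delta along c' by exactly
    2 dP(K, K') y.  By Euler's identity, adding k y to K adds k'' y to this
    error, so that K + k y is a Jacobi field as soon as k'' = - 2 dP(K, K'); the
    two constants of integration allow k(0) = k(s1) = 0.  The function dP(K, K')
    does not depend on the chart because second derivatives of the transition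
    maps are symmetric.  If K + k y vanished identically, then J would be
    tangential to c, with a coefficient d for which the Jacobi equation reads
    d'' = 0, so that d(0) = d(t1) = 0 would force J = 0. *)
From HB Require Import structures.
From mathcomp Require Import all_boot all_order all_algebra.
From mathcomp Require Import all_classical all_reals all_analysis.
From mathcomp Require Import ring lra.
Require Import Defs.
Import Order.TTheory GRing.Theory Num.Theory.
Import numFieldNormedType.Exports.

Set Implicit Arguments.
Unset Strict Implicit.
Unset Printing Implicit Defensive.

(** * Curves *)

Section Curves.
Variable R : realType.
Implicit Types (A B : set R) (E F : normedModType R) (t : R).

Lemma is_derive_unique E F (f : E -> F) x v d1 d2 :
  is_derive x v f d1 -> is_derive x v f d2 -> d1 = d2.
Proof. by move=> [_ <-] [_ <-]. Qed.

Lemma is_derive_val E F (f : E -> F) x v d d' :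
  d = d' -> is_derive x v f d -> is_derive x v f d'.
Proof. by move=> ->. Qed.

Lemma is_derive_diff E F (f : E -> F) x v :
  differentiable f x -> is_derive x v f ('d f x v).
Proof. by move=> df; split; [exact: diff_derivable|rewrite deriveE]. Qed.

Lemma is_derive1E E (f : R -> E) t d : is_derive t 1 f d -> derive1 f t = d.
Proof. by move=> [_ <-]; rewrite derive1E. Qed.

Lemma is_derive1_derivable E (f : R -> E) t :
  derivable f t 1 -> is_derive t 1 f (derive1 f t).
Proof. by move=> df; split => //; rewrite derive1E. Qed.

Lemma is_derive_continuous E (f : R -> E) t d :
  is_derive t 1 f d -> {for t, continuous f}.
Proof. by move=> [df _]; apply: differentiable_continuous; apply/derivable1_diffP. Qed.

Lemma is_derive_chain E F (f : R -> E) (g : E -> F) t df :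
  is_derive t 1 f df -> differentiable g (f t) ->
  is_derive t 1 (fun s => g (f s)) ('d g (f t) df).
Proof.
move=> [/derivable1_diffP dif <-] dg.
have dgf : differentiable (g \o f) t by exact: differentiable_comp.
split; first exact/derivable1_diffP.
by rewrite deriveE // diff_comp //= deriveE.
Qed.

Lemma is_derive_chain_at E F (f : R -> E) (g : E -> F) t df y : f t = y ->
  is_derive t 1 f df -> differentiable g y ->
  is_derive t 1 (fun s => g (f s)) ('d g y df).
Proof. by move=> <-; exact: is_derive_chain. Qed.

Lemma is_derive_pair E F (f : R -> E) (g : R -> F) t df dg :
  is_derive t 1 f df -> is_derive t 1 g dg ->
  is_derive t 1 (fun s => (f s, g s)) (df, dg).
Proof.
move=> [/derivable1_diffP dif <-] [/derivable1_diffP dig <-].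
have dp := differentiable_pair dif dig.
split; first exact/derivable1_diffP.
by rewrite deriveE // diff_pair //= !deriveE.
Qed.

Lemma is_derive_line E (x v : E) t : is_derive t 1 (fun e : R => x + e *: v) v.
Proof.
have -> : (fun e : R => x + e *: v) = cst x + ( *:%R^~ v) by [].
rewrite -[v in X in is_derive _ _ _ X]add0r; apply: is_deriveD.
split; first by apply/derivable1_diffP.
by rewrite deriveE // diff_val scale1r.
Qed.

Lemma is_derive_near E F (f g : E -> F) x v d (U : set E) :
  open U -> U x -> (forall y, U y -> f y = g y) ->
  is_derive x v f d -> is_derive x v g d.
Proof.
move=> oU Ux fg; apply: near_eq_is_derive.
by apply: filterS (open_nbhs_nbhs (conj oU Ux)).
Qed.

Lemma is_derive_rowP E n (f : E -> 'rV[R]_n) x v d :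
  is_derive x v f d <-> forall j, is_derive x v (fun y => f y 0 j) (d 0 j).
Proof.
split=> [[df <-] j|H].
  split; first by have /derivable_mxP := df; apply.
  by rewrite derive_mx // mxE.
have df : derivable f x v.
  by apply/derivable_mxP => i j; rewrite ord1; exact: (@ex_derive _ _ _ _ _ _ _ (H j)).
split => //; rewrite derive_mx //; apply/rowP => j; rewrite mxE.
by have [_ <-] := H j.
Qed.

Lemma is_derive_mul E (f g : E -> R) x v df dg :
  is_derive x v f df -> is_derive x v g dg ->
  is_derive x v (fun y => f y * g y) (f x * dg + g x * df).
Proof. by move=> Hf Hg; exact: is_deriveM. Qed.

Lemma is_derive_comp E (f : R -> R) (g : R -> E) t df dg :
  is_derive t 1 f df -> is_derive (f t) 1 g dg ->
  is_derive t 1 (fun s => g (f s)) (df *: dg).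
Proof.
move=> Hf Hg; have [dig <-] := Hg.
have dg' : differentiable g (f t) by apply/derivable1_diffP.
have E1 : 'd g (f t) df = df *: 'D_1 g (f t) by rewrite diff1E // derive1E.
rewrite -E1; exact: is_derive_chain.
Qed.

Lemma is_derive_scale n (k : R -> R) (f : R -> 'rV[R]_n) t dk df :
  is_derive t 1 k dk -> is_derive t 1 f df ->
  is_derive t 1 (fun s => k s *: f s) (dk *: f t + k t *: df).
Proof.
move=> Hk /is_derive_rowP Hf; apply/is_derive_rowP => j; rewrite !mxE addrC.
have -> : (fun s => (k s *: f s) 0 j) = (fun s => k s * f s 0 j).
  by apply/funext => s; rewrite mxE.
rewrite [dk * _]mulrC; exact: is_derive_mul.
Qed.

Lemma derive1_near E A (f g : R -> E) t :
  open A -> A t -> (forall s, A s -> f s = g s) -> derive1 f t = derive1 g t.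
Proof.
move=> oA At fg; rewrite !derive1E; apply: near_eq_derive.
exact: filterS (open_nbhs_nbhs (conj oA At)).
Qed.

Lemma is_derive_derive1 E A (f f' : R -> E) t d : open A -> A t ->
  (forall s, A s -> is_derive s 1 f (f' s)) -> is_derive t 1 f' d ->
  is_derive t 1 (derive1 f) d.
Proof.
move=> oA At ff'; apply: (is_derive_near oA At) => s As.
exact/esym/is_derive1E/ff'.
Qed.

(* Fixing the number k of derivatives makes the closure properties of
   [smooth_on] for curves provable by induction on k. *)
Fixpoint diffn E (A : set R) k (f : R -> E) : Prop :=
  if k is k'.+1 then (forall t, A t -> derivable f t 1) /\ diffn A k' f^`()
  else True.

Lemma diffn_derive1P E A k (f : R -> E) : diffn A k.+1 f -> diffn A k (derive1 f).
Proof. by case. Qed.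

Lemma diffn_derivable E A k (f : R -> E) t : diffn A k.+1 f -> A t ->
  is_derive t 1 f (derive1 f t).
Proof. by move=> [df _] At; apply/is_derive1_derivable/df. Qed.

Lemma diffn_ext E A k (f g : R -> E) : open A -> (forall t, A t -> f t = g t) ->
  diffn A k f -> diffn A k g.
Proof.
move=> oA; elim: k f g => //= k IH f g fg [df dk]; split=> [t At|].
  exact: (@ex_derive _ _ _ _ _ _ _
    (is_derive_near oA At fg (is_derive1_derivable (df t At)))).
apply: IH dk => t At; apply/esym/is_derive1E.
exact: (is_derive_near oA At fg (is_derive1_derivable (df t At))).
Qed.

Lemma diffnS E A k (f : R -> E) : diffn A k.+1 f -> diffn A k f.
Proof. by elim: k f => //= k IH f [df /IH]. Qed.

Lemma diffn_derive1 E A k (f f' : R -> E) : open A ->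
  (forall t, A t -> is_derive t 1 f (f' t)) -> diffn A k f' -> diffn A k.+1 f.
Proof.
move=> oA ff' dk; split=> [t At|]; first exact: (@ex_derive _ _ _ _ _ _ _ (ff' t At)).
apply: diffn_ext dk => // t At; apply/esym/is_derive1E/ff'/At.
Qed.

Lemma diffn_sub E A B k (f : R -> E) : B `<=` A -> diffn A k f -> diffn B k f.
Proof.
move=> BA; elim: k f => //= k IH f [df /IH dk]; split => // t /BA; exact: df.
Qed.

(** Differentiability is checked point by point. This passes from the chart domains, which cover the
    parameter interval, to the whole interval. *)
Lemma diffn_cover E (T : Type) (B : T -> set R) A k (f : R -> E) :
  (forall t, A t -> exists i, B i t) ->
  (forall i, diffn (B i) k f) -> diffn A k f.
Proof.
move=> cov; elim: k f => //= k IH f H; split=> [t /cov [i]|].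
  by apply: (H i).1.
by apply: IH => i; apply: (H i).2.
Qed.

Lemma diffn_cst E A k (a : E) : open A -> diffn A k (fun _ => a).
Proof.
move=> oA; elim: k a => // k IH a.
by apply: (@diffn_derive1 _ _ _ _ (fun=> 0)) => // t _; exact: is_derive_cst.
Qed.

Lemma diffnD E A k (f g : R -> E) : open A -> diffn A k f -> diffn A k g ->
  diffn A k (fun t => f t + g t).
Proof.
move=> oA; elim: k f g => // k IH f g [df df'] [dg dg'].
apply: (@diffn_derive1 _ _ _ _ (fun t => derive1 f t + derive1 g t)) => // [t At|].
  by apply: is_deriveD; apply: is_derive1_derivable; [apply: df|apply: dg].
exact: IH.
Qed.

Lemma diffnM A k (f g : R -> R) : open A -> diffn A k f -> diffn A k g ->
  diffn A k (fun t => f t * g t).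
Proof.
move=> oA; elim: k f g => // k IH f g Df Dg.
have [df df'] := Df; have [dg dg'] := Dg.
apply: (@diffn_derive1 _ _ _ _ (fun t => f t * derive1 g t + g t * derive1 f t)) => // [t At|].
  by apply: is_deriveM; apply: is_derive1_derivable; [apply: df|apply: dg].
by apply: diffnD => //; apply: IH => //; apply: diffnS.
Qed.

Lemma diffn_sum A k n (f : 'I_n -> R -> R) : open A ->
  (forall i, diffn A k (f i)) -> diffn A k (fun t => \sum_(i < n) f i t).
Proof.
move=> oA; elim: n f => [|n IH] f df.
  by apply: diffn_ext (@diffn_cst _ A k (0 : R) oA) => // t _; rewrite big_ord0.
apply: diffn_ext (@diffnD _ A k (fun t => \sum_(i < n) f (lift ord0 i) t)
  (f ord0) oA _ _) => //.
  by move=> t _; rewrite big_ord_recl addrC.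
by apply: IH => i; apply: df.
Qed.

Lemma diffn_comp A B k (f g : R -> R) : open A -> (forall t, A t -> B (f t)) ->
  diffn A k f -> diffn B k g -> diffn A k (fun t => g (f t)).
Proof.
move=> oA AB; elim: k f g AB => // k IH f g AB Df Dg.
have [df df'] := Df; have [dg dg'] := Dg.
apply: (@diffn_derive1 _ A k (fun t => g (f t))
  (fun t => derive1 f t * derive1 g (f t))) => // [t At|].
  apply: is_derive_comp; apply: is_derive1_derivable; first exact: df.
  exact/dg/AB.
by apply: diffnM => //; apply: IH => //; apply: diffnS.
Qed.

Lemma diffn_rowP n A k (f : R -> 'rV[R]_n) : open A ->
  diffn A k f <-> forall j, diffn A k (fun t => f t 0 j).
Proof.
move=> oA; elim: k f => // k IH f; split=> [[df /IH df'] j|H].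
  apply: (@diffn_derive1 _ _ _ _ (fun t => derive1 f t 0 j)) => // t At.
  by have /is_derive_rowP := is_derive1_derivable (df t At); apply.
have df t : A t -> is_derive t 1 f (\row_j derive1 (fun t => f t 0 j) t).
  move=> At; apply/is_derive_rowP => j; rewrite mxE.
  by apply/is_derive1_derivable/(H j).1.
apply: (diffn_derive1 _ df) => //; apply/IH => j.
by apply: diffn_ext (H j).2 => // t At; rewrite mxE.
Qed.

Lemma diffn_scale n A j (k : R -> R) (f : R -> 'rV[R]_n) : open A ->
  diffn A j k -> diffn A j f -> diffn A j (fun t => k t *: f t).
Proof.
move=> oA Dk /(diffn_rowP _ _ oA) Df; apply/(diffn_rowP _ _ oA) => i.
apply: diffn_ext (diffnM oA Dk (Df i)) => // t _; by rewrite mxE.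
Qed.

(** On the line, ['D_v f] is [v] times the ordinary derivative, so the iterated directional
    derivatives in [smooth_on] are scalar multiples of the iterated [derive1]. *)
Lemma smooth_onP E A (f : R -> E) : open A ->
  smooth_on A f <-> forall k, diffn A k f.
Proof.
move=> oA; split=> [sf k|df s].
  (* The list [s] stays general: each further derivative in direction 1 is absorbed by passing to
     [1 :: s]. *)
  suff H s : diffn A k (foldr (fun v g => 'D_v g) f s) by exact: (H [::]).
  elim: k s => // k IH s; split=> [t At|].
    exact/derivable1_diffP/sf.
  apply: diffn_ext (IH (1 :: s)) => // t At /=; by rewrite derive1E.
suff H k : diffn A k (foldr (fun v g => 'D_v g) f s).
  by move=> t At; apply/derivable1_diffP; apply: (H 1%N).1.
elim: s k => //= v s IH k.
have Zv h : diffn A k h -> diffn A k (fun t => v *: h t : E).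
  elim: k {IH} h => // k IHk h [dh dh'].
  apply: (@diffn_derive1 _ _ _ _ (fun t => v *: derive1 h t)) => // [t At|].
    by apply: is_deriveZ; apply: is_derive1_derivable; apply: dh.
  exact: IHk.
apply: diffn_ext (Zv _ (IH k.+1).2) => // t At.
have /derivable1_diffP dt := (IH 1%N).1 t At.
by rewrite deriveE // diff1E.
Qed.

Lemma is_derive0_cst A (f : R -> R) : is_interval A ->
  (forall t, A t -> is_derive t 1 f 0) -> forall a b, A a -> A b -> f a = f b.
Proof.
move=> iA df; suff H a b : A a -> A b -> a < b -> f a = f b.
  move=> a b Aa Ab; case: (ltgtP a b) => [|/H->|->]; by [apply: H|].
move=> Aa Ab ab.
have sub t : a <= t -> t <= b -> A t by move=> t1 t2; apply: (iA a b) => //; apply/andP.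
have [||c _] := @MVT _ f (fun=> 0) a b ab.
- by move=> t; rewrite in_itv/= => /andP[/ltW ta /ltW tb]; apply/df/sub.
- apply: derivable_within_continuous => t; rewrite in_itv/= => /andP[ta tb].
  exact: (@ex_derive _ _ _ _ _ _ _ (df _ (sub _ ta tb))).
by rewrite mul0r => /eqP; rewrite subr_eq0 => /eqP.
Qed.

End Curves.

(** * Symmetry of second derivatives *)

Section Schwarz.
Variables (R : realType) (E : normedModType R).
Implicit Types (f : E -> R) (x u v : E) (U : set E).

Lemma differentiable_le f x (e : R) : differentiable f x -> 0 < e ->
  exists2 d, 0 < d & forall k, `|k| < d ->
    `|f (x + k) - f x - 'd f x k| <= e * `|k|.
Proof.
move=> /diff_locally df e0.
have /eqaddoP /(_ e e0) /nbhs_ballP [d /= d0 H] := df.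
exists d => // k kd; have := H k; rewrite -ball_normE /= sub0r normrN => /(_ kd).
by rewrite /= !fctE opprD addrA (addrC k x).
Qed.

(** The mean value theorem turns the second difference into [h] times an increment of ['D_u f];
    linearizing ['D_u f] at the single point [x] evaluates that increment up to an error [e * h]. *)
Lemma second_difference f x u v U (e : R) : open U -> U x ->
  (forall y, U y -> differentiable f y) -> differentiable ('D_u f) x -> 0 < e ->
  exists2 d, 0 < d & forall h : R, 0 < h -> h < d ->
    `|f (x + h *: v + h *: u) - f (x + h *: u) - (f (x + h *: v) - f x)
      - h * h * 'D_v ('D_u f) x| <= e * (h * h).
Proof.
move=> oU Ux df dD e0.
(* The two linearization errors below are together at most [e / N] times [h * |v| + 2 * h * |u|],
   hence at most [e * h]; the summand 1 keeps [N] positive. *)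
pose N := `|v| + 2 * `|u| + 1.
have N0 : 0 < N by rewrite /N addrC ltr_wpDr // addr_ge0 // mulr_ge0.
have eN0 : 0 < e / N by rewrite divr_gt0.
have [d1 d10 Hd1] := differentiable_le dD eN0.
have /nbhs_ballP [r /= r0 Hr] : nbhs x U by apply: open_nbhs_nbhs.
have inU k : `|k| < r -> U (x + k).
  by move=> kr; apply: Hr; rewrite -ball_normE /= opprD addrA subrr sub0r normrN.
exists (Num.min d1 r / N); first by rewrite divr_gt0 // lt_min d10.
move=> h h0; rewrite ltr_pdivlMr // lt_min => /andP[hd hr].
have small t a : 0 <= t <= h -> 0 <= a <= h ->
    `|a *: v + t *: u| <= a * `|v| + t * `|u| /\ a * `|v| + t * `|u| < h * N.
  move=> /andP[t0 th] /andP[a0 ah]; split.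
    by rewrite (le_trans (ler_normD _ _)) // !normrZ !ger0_norm.
  rewrite /N; have := normr_ge0 v; have := normr_ge0 u; nra.
(* The mean value theorem is applied to [g], whose value at [h] minus its value
   at 0 is the second difference. *)
pose g (t : R) := f (x + h *: v + t *: u) - f (x + t *: u).
pose g' (t : R) := 'D_u f (x + h *: v + t *: u) - 'D_u f (x + t *: u).
have dline y t : U (y + t *: u) -> is_derive t 1 (fun s => f (y + s *: u)) ('D_u f (y + t *: u)).
  move=> /df dy; rewrite deriveE //.
  apply: (@is_derive_chain _ _ _ (fun s : R => y + s *: u) f) => //.
  exact: is_derive_line.
have hh : 0 <= h <= h by rewrite lexx ltW.
have dg t : 0 <= t <= h -> is_derive t 1 g (g' t).
  move=> th; apply: is_deriveB; apply: dline.
    rewrite -addrA; apply: inU; have [H1 H2] := small t h th hh.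
    exact: le_lt_trans H1 (lt_trans H2 hr).
  apply: inU; have [] := small t 0 th; first by rewrite lexx ltW.
  rewrite scale0r add0r => H1 H2; exact: le_lt_trans H1 (lt_trans H2 hr).
have [||c] := @MVT _ g g' 0 h h0.
- by move=> t; rewrite in_itv/= => /andP[/ltW t0 /ltW th]; apply/dg/andP.
- apply: derivable_within_continuous => t; rewrite in_itv/= => th.
  exact: (@ex_derive _ _ _ _ _ _ _ (dg _ th)).
rewrite in_itv/= => /andP[/ltW c0 /ltW ch]; rewrite subr0 {1 2}/g scale0r !addr0 => ->.
have [Hc1 Hc2] : `|h *: v + c *: u| <= h * `|v| + c * `|u| /\ h * `|v| + c * `|u| < h * N.
  by apply: small => //; apply/andP.
have [Hc3 Hc4] : `|c *: u| <= c * `|u| /\ c * `|u| < h * N.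
  have [||] := small c 0; rewrite ?scale0r ?mul0r ?add0r //; first exact/andP.
  by rewrite lexx ltW.
have H1 := Hd1 _ (le_lt_trans Hc1 (lt_trans Hc2 hd)).
have H2 := Hd1 _ (le_lt_trans Hc3 (lt_trans Hc4 hd)).
(* By linearity the differential of ['D_u f] at [x] changes by [h] times its value at [v] between
   [c *: u] and [h *: v + c *: u], so what is left is [h] times a difference of two linearization
   errors. *)
rewrite (_ : g' c * h - _ = h *
  (('D_u f (x + (h *: v + c *: u)) - 'D_u f x - 'd ('D_u f) x (h *: v + c *: u))
   - ('D_u f (x + c *: u) - 'D_u f x - 'd ('D_u f) x (c *: u)))); last first.
  have -> : 'd ('D_u f) x (h *: v + c *: u) = h * 'd ('D_u f) x v + 'd ('D_u f) x (c *: u).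
    by rewrite linearD linearZ.
  rewrite addrA deriveE // /g'; ring.
rewrite normrM gtr0_norm // mulrCA ler_pM2l //.
apply: (le_trans (ler_normB _ _)).
apply: (le_trans (lerD H1 H2)); rewrite -mulrDr.
have -> : e * h = e / N * (h * N) by field; rewrite gt_eqF.
rewrite ler_pM2l // /N; move: Hc1 Hc3; have := normr_ge0 v; have := normr_ge0 u; nra.
Qed.

(** The second difference is symmetric in [u] and [v], so both mixed derivatives, multiplied by
    [h * h], lie within [e / 2 * (h * h)] of the same number. *)
Lemma schwarz f x u v U : open U -> U x ->
  (forall y, U y -> differentiable f y) ->
  differentiable ('D_u f) x -> differentiable ('D_v f) x ->
  'D_v ('D_u f) x = 'D_u ('D_v f) x.
Proof.
move=> oU Ux df du dv; apply/eqP; rewrite -subr_eq0 -normr_le0.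
apply/ler_addgt0Pr => e e0; rewrite add0r.
have e20 : 0 < e / 2 by rewrite divr_gt0.
have [d1 d10 H1] := second_difference v oU Ux df du e20.
have [d2 d20 H2] := second_difference u oU Ux df dv e20.
pose h := Num.min d1 d2 / 2.
have m0 : 0 < Num.min d1 d2 by rewrite lt_min d10.
have h0 : 0 < h by rewrite divr_gt0.
have : h < Num.min d1 d2 by rewrite /h; lra.
rewrite lt_min => /andP[hd1 hd2].
have {}H1 := H1 h h0 hd1; have {}H2 := H2 h h0 hd2.
have hh0 : 0 < h * h by rewrite mulr_gt0.
rewrite -(ler_pM2l hh0) -{1}(gtr0_norm hh0) -normrM.
move: H1 H2; rewrite (addrAC x (h *: v)) => H1 H2.
set a := f _ - _ - _ in H1; set b := f _ - _ - _ in H2.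
rewrite [X in `|X|](_ : _ = (b - h * h * 'D_u ('D_v f) x) - (a - h * h * 'D_v ('D_u f) x)).
  have -> : h * h * e = e / 2 * (h * h) + e / 2 * (h * h) by field.
  exact: (le_trans (ler_normB _ _) (lerD H2 H1)).
rewrite /a /b; move: ('D_v _ x) ('D_u _ x) (f (x + h *: u + h *: v)).
move: (f (x + h *: u)) (f (x + h *: v)) (f x) => ? ? ? ? ? ?; ring.
Qed.

End Schwarz.

(** * Primitives on an open interval *)

Section Primitive.
Variable R : realType.
Local Notation mu := (@lebesgue_measure R).

(** The primitive is the oriented integral from 0, so that it makes sense on both sides of 0. *)
Lemma continuous_primitive (A : set R) (f : R -> R) :
  open A -> is_interval A -> A 0 -> (forall t, A t -> {for t, continuous f}) ->
  exists F : R -> R, forall t, A t -> is_derive t 1 F (f t).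
Proof.
move=> oA iA A0 cf.
pose F x := if 0 <= x then \int[mu]_(t in `]0, x]) f t else - \int[mu]_(t in `]x, 0]) f t.
exists F => t At.
have ext s : A s -> exists2 d, 0 < d & forall r, `|s - r| < d -> A r.
  move=> As; have /nbhs_ballP [d d0 H] := open_nbhs_nbhs (conj oA As).
  by exists d => // r rd; apply: H; rewrite -ball_normE.
have dec s : A s -> exists2 a, A a & a < s.
  move=> /ext [d d0 H]; exists (s - d / 2); last by lra.
  by apply: H; rewrite opprB addrC subrK ger0_norm; lra.
have inc s : A s -> exists2 a, A a & s < a.
  move=> /ext [d d0 H]; exists (s + d / 2); last by lra.
  by apply: H; rewrite opprD addrA subrr sub0r normrN ger0_norm; lra.
(* A point [a] to the left of 0 and of [t] gives a common lower limit: near [t], [F] is the integral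
   from [a] minus the constant [C], and the fundamental theorem of calculus applies to that
   integral. *)
have [a Aa [a0 at_]] : exists2 a, A a & a < 0 /\ a < t.
  have [t0|t0] := ltP t 0.
    by have [a Aa at_] := dec _ At; exists a => //; split => //; lra.
  by have [a Aa at_] := dec _ A0; exists a => //; split => //; lra.
have [b Ab [b0 tb]] : exists2 b, A b & 0 < b /\ t < b.
  have [t0|t0] := ltP t 0.
    by have [b Ab bt] := inc _ A0; exists b => //; split => //; lra.
  by have [b Ab bt] := inc _ At; exists b => //; split => //; lra.
have intf : mu.-integrable `[a, b] (EFin \o f).
  apply: continuous_compact_integrable; first exact: segment_compact.
  apply/continuous_in_subspaceT => s; rewrite inE /= in_itv /= => sab.
  by apply: cf; apply: (iA a b).
have [df f'] := @continuous_FTC1_closed _ f a t b tb intf at_ (cf _ At).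
pose C := \int[mu]_(t in `[a, 0]) f t.
have dG : is_derive t 1 (fun x => \int[mu]_(t in `[a, x]) f t - C) (f t).
  rewrite -[f t]subr0; apply: is_deriveB.
  by rewrite -[X in is_derive _ _ _ X]f'; apply: is_derive1_derivable.
apply: (@is_derive_near _ _ _ _ _ _ _ _ `]a, b[%classic _ _ _ dG).
- exact: itv_open.
- by rewrite /= in_itv /= at_.
move=> y; rewrite /= in_itv /= /F /C => /andP[ay yb].
have sub c : c < b -> mu.-integrable `[a, c] (EFin \o f).
  move=> cb; apply: integrableS intf => //; apply: subset_itvl.
  by rewrite bnd_simp ltW.
case: ifP => [y0|/negbT].
  rewrite Rintegral_itvB ?bnd_simp //; [exact: sub|exact: ltW].
rewrite -ltNge => y0; rewrite -opprB; congr (- _).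
rewrite Rintegral_itvB ?bnd_simp //; [exact: sub|exact: ltW..].
Qed.
Lemma double_primitive (A : set R) (q : R -> R) (s1 : R) :
  open A -> is_interval A -> A 0 -> s1 != 0 ->
  (forall k, diffn A k q) ->
  exists k : R -> R, [/\ forall j, diffn A j k, k 0 = 0, k s1 = 0 &
    forall t, A t -> derive1 (derive1 k) t = q t].
Proof.
move=> oA iA A0 s10 Dq.
have [F1 dF1] : exists F : R -> R, forall t, A t -> is_derive t 1 F (q t).
  apply: (continuous_primitive oA iA A0) => t At.
  exact: is_derive_continuous (diffn_derivable (Dq 1%N) At).
have [F2 dF2] : exists F : R -> R, forall t, A t -> is_derive t 1 F (F1 t).
  apply: (continuous_primitive oA iA A0) => t At.
  exact: is_derive_continuous (dF1 t At).
(* Subtracting [F2 0] and adding [C * t] uses up the two constants of integration; the slope [C]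
   cancels [F2 s1 - F2 0] at [s1]. *)
pose C := (F2 0 - F2 s1) / s1.
pose k t := F2 t - F2 0 + C * t.
have dk t : A t -> is_derive t 1 k (F1 t + C).
  move=> At; apply: is_deriveD.
    rewrite -[F1 t]subr0; exact: is_deriveB (dF2 t At) (is_derive_cst (F2 0) t 1).
  have := is_derive_mul (is_derive_cst C t 1) (is_derive_id t 1).
  by apply: is_derive_val; rewrite mulr1 mulr0 addr0.
have dk2 t : A t -> is_derive t 1 (fun t => F1 t + C) (q t).
  move=> At; rewrite -[q t]addr0; exact: is_deriveD (dF1 t At) (is_derive_cst C t 1).
exists k; split.
- move=> j; apply: diffnS; apply: diffnS.
  by apply: (diffn_derive1 oA dk); apply: (diffn_derive1 oA dk2).
- by rewrite /k subrr mulr0 addr0.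
- by rewrite /k /C divfK // addrC subrKA subrr.
- by move=> t At; exact: (is_derive1E (is_derive_derive1 oA At dk (dk2 t At))).
Qed.

End Primitive.

(** * Smooth maps *)

Section Smooth.
Variable R : realType.
Implicit Types (E F G : normedModType R).

Lemma differentiable_near E F (f g : E -> F) x (U : set E) :
  open U -> U x -> (forall y, U y -> f y = g y) ->
  differentiable f x -> differentiable g x.
Proof.
move=> oU Ux fg df.
have [cd fE] := (diff_locallyP _ _).1 df.
have gE : g \o shift x = cst (g x) + 'd f x +o_ (0 : E) id.
  apply/eqaddoP => e e0; move/eqaddoP : fE => /(_ e e0).
  apply: filter_app.
  have : \forall y \near 0, U (y + x).
    have : \forall y \near x, U y by exact: open_nbhs_nbhs.
    by rewrite (near_shift 0) subr0.
  apply: filterS => y Uy /=; rewrite !fctE /= !fg //.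
by apply/diff_locallyP; rewrite (diff_unique cd gE).
Qed.

Lemma smooth_on_derive E F (U : set E) (f : E -> F) v :
  smooth_on U f -> smooth_on U ('D_v f).
Proof. by move=> sf s x Ux; have := sf (rcons s v) x Ux; rewrite foldr_rcons. Qed.

Lemma smooth_on_differentiable E F (U : set E) (f : E -> F) x :
  smooth_on U f -> U x -> differentiable f x.
Proof. by move=> sf; exact: (sf [::]). Qed.

(** A continuous linear map commutes with directional derivatives, so the iterated derivatives of
    [l \o f] are the images under [l] of those of [f]. *)
Lemma smooth_on_linear_comp E F G (U : set E) (f : E -> F) (l : {linear F -> G}) :
  continuous l -> open U -> smooth_on U f -> smooth_on U (l \o f).
Proof.
move=> cl oU sf.
have dl y : differentiable l y by exact: linear_differentiable.
have H s : forall x, U x ->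
    l (foldr (fun v g => 'D_v g) f s x) = foldr (fun v g => 'D_v g) (l \o f) s x.
  elim: s => // v s IH x Ux /=.
  have ds := sf s x Ux.
  rewrite -(@near_eq_derive _ _ _ (l \o foldr (fun v g => 'D_v g) f s)); last first.
    by apply: filterS (open_nbhs_nbhs (conj oU Ux)).
  rewrite !deriveE //; last exact: differentiable_comp.
  by rewrite (diff_comp ds (dl _)) /= diff_lin.
move=> s x Ux; apply: (differentiable_near oU Ux (H s)).
exact: differentiable_comp (sf s x Ux) (dl _).
Qed.

Lemma smooth_on_coord E n (U : set E) (f : E -> 'rV[R]_n) j :
  open U -> smooth_on U f -> smooth_on U (fun x => f x 0 j).
Proof.
move=> oU sf.
have lin : linear (fun A : 'rV[R]_n => A 0 j) by move=> k A B; rewrite !mxE.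
pose lM := GRing.isLinear.Build _ _ _ _ _ lin.
pose L : {linear 'rV[R]_n -> R} := HB.pack (fun A : 'rV[R]_n => A 0 j) lM.
apply: (@smooth_on_linear_comp _ _ _ U f L) => //.
by move=> A; apply: differentiable_continuous; exact: differentiable_coord.
Qed.

Lemma schwarz_row E n (U : set E) (f : E -> 'rV[R]_n) u v x :
  open U -> smooth_on U f -> U x -> 'D_v ('D_u f) x = 'D_u ('D_v f) x.
Proof.
move=> oU sf Ux; apply/rowP => j.
have H w w' : 'D_w ('D_w' f) x 0 j = 'D_w ('D_w' (fun y => f y 0 j)) x.
  have dw := smooth_on_differentiable (smooth_on_derive w' sf) Ux.
  have /is_derive_rowP /(_ j) [_ <-] := derivableP (diff_derivable (v:=w) dw).
  apply: near_eq_derive; apply: filterS (open_nbhs_nbhs (conj oU Ux)) => y Uy.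
  have dy := smooth_on_differentiable sf Uy.
  by have /is_derive_rowP /(_ j) [_ <-] := derivableP (diff_derivable (v:=w') dy).
apply: etrans (H v u) _.
apply: etrans _ (esym (H u v)).
have sfj := smooth_on_coord j oU sf.
apply: (@schwarz _ _ _ _ _ _ U) => // [y Uy||].
- exact: smooth_on_differentiable Uy.
- by apply: (smooth_on_differentiable _ Ux); exact: smooth_on_derive.
- by apply: (smooth_on_differentiable _ Ux); exact: smooth_on_derive.
Qed.

Lemma linear_row n G (l : {linear 'rV[R]_n -> G}) (v : 'rV[R]_n) :
  l v = \sum_(j < n) v 0 j *: l (delta_mx 0 j).
Proof. by rewrite {1}[v]row_sum_delta linear_sum; apply: eq_bigr => j _; rewrite linearZ. Qed.

Lemma linear_row_pair n G (l : {linear ('rV[R]_n * 'rV[R]_n)%type -> G}) (u w : 'rV[R]_n) :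
  l (u, w) = \sum_(j < n) u 0 j *: l (delta_mx 0 j, 0)
           + \sum_(j < n) w 0 j *: l (0, delta_mx 0 j).
Proof.
have -> : (u, w) = \sum_(j < n) u 0 j *: (delta_mx 0 j, 0 : 'rV[R]_n)
           + \sum_(j < n) w 0 j *: (0 : 'rV[R]_n, delta_mx 0 j).
  rewrite {1}[u]row_sum_delta {1}[w]row_sum_delta.
  rewrite [RHS]surjective_pairing /= !(raddf_sum fst) !(raddf_sum snd) /=.
  congr (_, _); first by rewrite [X in _ + X]big1 ?addr0 // => j _; rewrite scaler0.
  by rewrite [X in X + _]big1 ?add0r // => j _; rewrite scaler0.
by rewrite linearD !linear_sum; congr (_ + _); apply: eq_bigr => j _; rewrite linearZ.
Qed.

Lemma is_derive_sumf n (f : 'I_n -> R -> R) (d : 'I_n -> R) (t : R) :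
  (forall i, is_derive t 1 (f i) (d i)) ->
  is_derive t 1 (fun s => \sum_(i < n) f i s) (\sum_(i < n) d i).
Proof. by move=> /is_derive_sum; rewrite fct_sumE. Qed.

(** By the chain rule the derivative is a sum of products of components of [x'] and [y'] with
    partial derivatives of [F] along the curve. These partial derivatives are again smooth, so the
    induction on [k] runs over all [F]. *)
Lemma diffn_comp_pair n (U : set ('rV[R]_n * 'rV[R]_n)) A k
    (F : 'rV[R]_n * 'rV[R]_n -> R) (x y : R -> 'rV[R]_n) :
  open A -> smooth_on U F -> (forall t, A t -> U (x t, y t)) ->
  diffn A k x -> diffn A k y -> diffn A k (fun t => F (x t, y t)).
Proof.
move=> oA + AU; elim: k F => // k IH F sF Dx Dy.
have [dx dx'] := Dx; have [dy dy'] := Dy.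
pose F' t := \sum_(j < n) derive1 x t 0 j * 'D_(delta_mx 0 j, 0) F (x t, y t)
           + \sum_(j < n) derive1 y t 0 j * 'D_(0, delta_mx 0 j) F (x t, y t).
apply: (@diffn_derive1 _ _ A k (fun t => F (x t, y t)) F') => // [t At|].
  have dF := smooth_on_differentiable sF (AU t At).
  have -> : F' t = 'd F (x t, y t) (derive1 x t, derive1 y t).
    by rewrite linear_row_pair /F'; congr (_ + _); apply: eq_bigr => j _; rewrite deriveE.
  apply: (is_derive_chain _ dF); apply: is_derive_pair; apply: is_derive1_derivable; auto.
have [Dx1 Dy1] : diffn A k x /\ diffn A k y by split; exact: diffnS.
apply: diffnD => //; apply: diffn_sum => // j; apply: diffnM => //.
- by move/(diffn_rowP _ _ oA) : dx'.
- by apply: (IH ('D_(delta_mx 0 j, 0) F)) => //; exact: smooth_on_derive.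
- by move/(diffn_rowP _ _ oA) : dy'.
- by apply: (IH ('D_(0, delta_mx 0 j) F)) => //; exact: smooth_on_derive.
Qed.

(** Expanding [K] in basis vectors, the product rule gives second derivatives of [tau] in the
    directions [y] and [delta_mx 0 j]; their symmetry lets them be summed into one derivative in the
    direction [K t]. *)
Lemma is_derive_tangent n m (U : set 'rV[R]_n) (tau : 'rV[R]_n -> 'rV[R]_m) (A : set R)
    (x K : R -> 'rV[R]_n) (t : R) y K' :
  open U -> smooth_on U tau -> open A -> A t -> (forall s, A s -> U (x s)) ->
  is_derive t 1 x y -> is_derive t 1 K K' ->
  is_derive t 1 (fun s => 'd tau (x s) (K s))
    ('d tau (x t) K' + 'D_(K t) ('D_y tau) (x t)).
Proof.
move=> oU stau oA At AU dx dK; have Ut := AU t At.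
have dD w : differentiable ('D_w tau) (x t).
  exact: (smooth_on_differentiable (smooth_on_derive w stau) Ut).
apply: (@is_derive_near _ _ _ (fun s => \sum_(j < n) K s 0 j *: 'D_(delta_mx 0 j) tau (x s))
   _ _ _ _ A oA At).
  move=> s As; have ds := smooth_on_differentiable stau (AU s As).
  by rewrite [RHS]linear_row; apply: eq_bigr => j _; rewrite deriveE.
apply/is_derive_rowP => i.
have -> : (fun s => (\sum_(j < n) K s 0 j *: 'D_(delta_mx 0 j) tau (x s)) 0 i) =
   (fun s => \sum_(j < n) K s 0 j * 'D_(delta_mx 0 j) tau (x s) 0 i).
  by apply/funext => s; rewrite summxE; apply: eq_bigr => j _; rewrite mxE.
have -> : ('d tau (x t) K' + 'D_(K t) ('D_y tau) (x t)) 0 i =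
  \sum_(j < n) (K t 0 j * 'D_y ('D_(delta_mx 0 j) tau) (x t) 0 i
     + 'D_(delta_mx 0 j) tau (x t) 0 i * K' 0 j).
  rewrite mxE big_split /= addrC; congr (_ + _).
    have HS j : 'd ('D_y tau) (x t) (delta_mx 0 j) = 'D_y ('D_(delta_mx 0 j) tau) (x t).
      rewrite -(deriveE _ (dD y)); exact: schwarz_row oU stau Ut.
    rewrite (deriveE _ (dD y)) linear_row summxE; apply: eq_bigr => j _.
    by rewrite mxE (HS j).
  rewrite linear_row summxE; apply: eq_bigr => j _; rewrite mxE mulrC deriveE //.
  exact: smooth_on_differentiable Ut.
apply: is_derive_sumf => j; apply: is_deriveM.
  by have /is_derive_rowP := dK; apply.
have := is_derive_chain dx (dD (delta_mx 0 j)).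
by rewrite -deriveE // => /is_derive_rowP; apply.
Qed.

End Smooth.

(** * Charts and slit tangent bundles *)

Section Charts.
Variables (R : realType) (n : nat) (M : smooth_manifold R n).
Local Notation V := 'rV[R]_n.
Local Notation chi := (@atlas R n M).
Implicit Types (a b : atlas_index M) (z : V * V).

Lemma open_in_chart (I : set R) (c : R -> M) a :
  open I -> (forall t, I t -> {for t, continuous c}) -> open (in_chart I c a).
Proof.
move=> oI cc; rewrite openE => t [It dt]; apply: filterI.
  exact: open_nbhs_nbhs.
apply: (cc t It); apply: open_nbhs_nbhs; split => //; exact: open_dom.
Qed.

Lemma open_overlap a b : open (overlap (chi a) (chi b)).
Proof.
have -> : overlap (chi a) (chi b) =
    (coord (chi a) @` dom (chi a)) `&` icoord (chi a) @^-1` dom (chi b).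
  rewrite /overlap eqEsubset; split=> x.
    move=> [p [ap bp] <-]; split; first by exists p.
    by rewrite /= coordK.
  move=> [[p ap <-]] /=; rewrite coordK // => bp; by exists p.
have := @icoord_continuous _ _ _ (chi a).
rewrite continuous_open_subspace; last exact: open_image.
move=> ci; rewrite openE => x [ax bx]; apply: filterI.
  by apply: open_nbhs_nbhs; split => //; exact: open_image.
apply: (ci x); first by rewrite inE.
by apply: open_nbhs_nbhs; split => //; exact: open_dom.
Qed.

Lemma open_slit_over (U : set V) : open U -> open [set z : V * V | U z.1 /\ z.2 != 0].
Proof.
move=> oU.
have -> : [set z : V * V | U z.1 /\ z.2 != 0] =
    fst @^-1` U `&` snd @^-1` [set y | y != 0] by [].
apply: openI; apply: open_comp => //; first by move=> *; exact: cvg_fst.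
  by move=> *; exact: cvg_snd.
have -> : [set y : V | y != 0] = ~` [set 0].
  by apply/seteqP; split=> y /= /eqP.
apply: closed_openC; apply: accessible_closed_set1; apply: hausdorff_accessible.
exact: norm_hausdorff.
Qed.

Lemma open_slit a : open (slit a).
Proof. by apply: open_slit_over; exact: open_image. Qed.

Lemma open_slit_overlap a b : open (slit_overlap a b).
Proof. by apply: open_slit_over; exact: open_overlap. Qed.

Lemma slit_scale a z (l : R) : 0 < l -> slit a z -> slit a (z.1, l *: z.2).
Proof.
by move=> l0 [az z0]; split => //=; rewrite scaler_eq0 gt_eqF.
Qed.

(** Twice differentiable: what the Jacobi operator asks of a force, since [Phi] contains derivatives
    of [Gamma]. For [S - 2 P Delta] it follows from the product rule. *)
Definition C2_on (U : set (V * V)) (f : V * V -> R) : Prop :=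
  (forall z, U z -> differentiable f z) /\
  (forall v z, U z -> differentiable ('D_v f) z).

Lemma smooth_C2_on (U : set (V * V)) (f : V * V -> R) : smooth_on U f -> C2_on U f.
Proof.
move=> sf; split=> [z Uz|v z Uz]; first exact: smooth_on_differentiable sf Uz.
exact: (smooth_on_differentiable (smooth_on_derive v sf) Uz).
Qed.

Lemma snd_coord_linear (i : 'I_n) : exists2 L : {linear (V * V)%type -> R},
  continuous L & (fun z : V * V => z.2 0 i) = L.
Proof.
have lin : linear (fun z : V * V => z.2 0 i) by move=> k A B; rewrite !mxE.
pose lM := GRing.isLinear.Build _ _ _ _ _ lin.
pose L : {linear (V * V)%type -> R} := HB.pack (fun z : V * V => z.2 0 i) lM.
exists L => // y; apply: (@continuous_comp _ _ _ snd (fun A : V => A 0 i)).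
  exact: cvg_snd.
by apply: differentiable_continuous; exact: differentiable_coord.
Qed.

Lemma differentiable_snd_coord i z : differentiable (fun z : V * V => z.2 0 i) z /\
  (forall v, 'd (fun z : V * V => z.2 0 i) z v = v.2 0 i).
Proof.
have [L cL LE] := snd_coord_linear i.
rewrite LE; split; first exact: linear_differentiable.
by move=> v; rewrite (diff_lin (f := L) z cL) -LE.
Qed.

Lemma force_smooth (S : slit_field M) a i :
  smooth_on (slit a) (S a) -> smooth_on (slit a) (force S a i).
Proof.
move=> sS; have [L cL LE] := snd_coord_linear i.
have -> : force S a i = L \o S a by rewrite -LE.
by apply: smooth_on_linear_comp => //; exact: open_slit.
Qed.

Lemma diff_force (S : slit_field M) a i z v : differentiable (S a) z ->
  'd (force S a i) z v = ('d (S a) z v).2 0 i.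
Proof.
move=> dS; have [dl lE] := differentiable_snd_coord i (S a z).
rewrite -(lE ('d (S a) z v)).
exact: (congr1 (fun f : V * V -> R => f v) (diff_comp dS dl)).
Qed.

End Charts.

(** * The Jacobi operator in a chart *)

Section Jacobi.
Variables (R : realType) (n : nat) (M : smooth_manifold R n).
Implicit Types (S : slit_field M) (a : atlas_index M) (I : set R) (c : R -> M).

Definition C2_sode S : Prop :=
  (forall a z, slit a z -> (S a z).1 = z.2) /\
  (forall a i, C2_on (slit a) (force S a i)).

Lemma sode_C2 S : is_sode S -> C2_sode S.
Proof.
move=> [[sS _] S1]; split => // a i; apply: smooth_C2_on.
exact/force_smooth/sS.
Qed.

Lemma geodesic_in_chart_open S I c a : is_geodesic S I c -> open (in_chart I c a).
Proof. by move=> [[oI _] [cc _] _]; exact: open_in_chart. Qed.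

Lemma geodesic_derive S I c a t : is_geodesic S I c -> in_chart I c a t ->
  [/\ slit a (velocity c a t),
      is_derive t 1 (local_curve c a) (velocity c a t).2,
      is_derive t 1 (derive1 (local_curve c a)) (S a (velocity c a t)).2 &
      is_derive t 1 (velocity c a) (S a (velocity c a t))].
Proof.
move=> gc It; have oA := geodesic_in_chart_open (a:=a) gc.
have [_ [_ [sc c0]] cS] := gc.
have [dx [dx' _]] := (smooth_onP _ oA).1 (sc a) 2%N.
have H1 := is_derive1_derivable (dx t It).
have H2 := is_derive1_derivable (dx' t It).
have H3 := is_derive_pair H1 H2.
have vS := is_derive1E H3; rewrite -/(velocity c a) cS // in vS.
split => //.
- split; last exact: c0.
  by exists (c t) => //; case: It.
- by rewrite vS.
- by rewrite vS.
Qed.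

(** Since [Gamma] is [-1/2] times the derivative of the force in [xdot], the two terms [Gamma W']
    make up the [xdot] part of the differential; the terms quadratic in [Gamma] and those with
    [S(Gamma)] cancel against [Phi]. *)
Lemma jacobi_operatorE S I c (J : curve_field M) a t i :
  C2_sode S -> is_geodesic S I c -> smooth_on (in_chart I c a) (J a) ->
  in_chart I c a t ->
  (nabla S c (nabla S c J) a t + Phi_along S c J a t) 0 i =
  derive1 (derive1 (J a)) t 0 i
  - 'd (force S a i) (velocity c a t) (J a t, derive1 (J a) t).
Proof.
move=> [_ CS] gc sJ At; have oA := geodesic_in_chart_open (a:=a) gc.
have [zs _ _ dv] := geodesic_derive gc At.
set z := velocity c a t in zs dv *.
have [dJ [dJ' _]] := (smooth_onP _ oA).1 sJ 2%N.
have {}dJ := is_derive1_derivable (dJ t At).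
have {}dJ' := is_derive1_derivable (dJ' t At).
set W := J a in dJ dJ' *; set W' := derive1 W in dJ dJ' *; set W'' := derive1 W' in dJ' *.
(* The velocity is an integral curve of [S], so differentiating [Gamma] along it means
   differentiating in the direction [S a z], as in the last term of [Phi]. *)
have dG k j : is_derive t 1 (fun s => Gamma S a k j (velocity c a s))
    ('D_(S a z) (Gamma S a k j) z).
  have dg : differentiable (Gamma S a k j) z.
    have := (CS a k).2 (0, delta_mx 0 j) z zs.
    by move=> /(differentiableZ (- 2^-1)).
  rewrite (deriveE _ dg); exact: (is_derive_chain dv dg).
have dN k : is_derive t 1 (fun s => nabla S c J a s 0 k)
   (W'' t 0 k + \sum_(j < n) (Gamma S a k j z * W' t 0 j
                             + W t 0 j * 'D_(S a z) (Gamma S a k j) z)).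
  have -> : (fun s => nabla S c J a s 0 k) = (fun s => W' s 0 k +
     \sum_(j < n) Gamma S a k j (velocity c a s) * W s 0 j).
    by apply/funext => s; rewrite mxE.
  apply: is_deriveD; first by have /is_derive_rowP := dJ'; apply.
  apply: is_derive_sumf => j; apply: is_deriveM.
  by have /is_derive_rowP := dJ; apply.
have dNr : is_derive t 1 (nabla S c J a)
    (\row_k (W'' t 0 k + \sum_(j < n) (Gamma S a k j z * W' t 0 j
                                     + W t 0 j * 'D_(S a z) (Gamma S a k j) z))).
  by apply/is_derive_rowP => k; rewrite mxE; exact: dN.
have dphi : 'd (force S a i) z (W t, W' t) =
   \sum_(j < n) W t 0 j * 'D_(delta_mx 0 j, 0) (force S a i) z
   + \sum_(j < n) W' t 0 j * (- 2 * Gamma S a i j z).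
  rewrite linear_row_pair; congr (_ + _); apply: eq_bigr => j _.
    by rewrite (deriveE _ ((CS a i).1 _ zs)).
  rewrite /Gamma (deriveE _ ((CS a i).1 _ zs)) -[LHS]/(_ * _).
  by congr (_ * _); rewrite mulrA mulrNN mulfV ?mul1r // pnatr_eq0.
rewrite dphi mxE [nabla S c (nabla S c J) a t]/nabla mxE (is_derive1E dNr) mxE -/z.
rewrite /Phi_along mxE -/z -/W.
have -> : \sum_(j < n) Gamma S a i j z * nabla S c J a t 0 j =
  \sum_(j < n) Gamma S a i j z * W' t 0 j
  + \sum_(j < n) \sum_(k < n) Gamma S a i j z * (Gamma S a j k z * W t 0 k).
  rewrite -big_split /=; apply: eq_bigr => j _.
  by rewrite mxE mulrDr mulr_sumr.
have -> : \sum_(j < n) Phi S a i j z * W t 0 j =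
  - (\sum_(j < n) W t 0 j * 'D_(delta_mx 0 j, 0) (force S a i) z)
  - \sum_(j < n) \sum_(k < n) Gamma S a i j z * (Gamma S a j k z * W t 0 k)
  - \sum_(j < n) W t 0 j * 'D_(S a z) (Gamma S a i j) z.
  (* Exchanging the two summations lets the common factor [W t 0 j] be taken out of the quadratic
     terms, which then have the form found in [Phi]. *)
  rewrite [X in _ - X - _]exchange_big /= -!sumrN -!big_split /=.
  apply: eq_bigr => j _.
  have -> : \sum_(k < n) Gamma S a i k z * (Gamma S a k j z * W t 0 j) =
      (\sum_(k < n) Gamma S a k j z * Gamma S a i k z) * W t 0 j.
    by rewrite mulr_suml; apply: eq_bigr => k _; rewrite mulrA (mulrC (Gamma S a i k z)).
  rewrite /Phi !mulrBl mulNr (mulrC (W t 0 j)) (mulrC (W t 0 j)) //.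
have -> : \sum_(j < n) W' t 0 j * (- 2 * Gamma S a i j z) =
   - 2 * \sum_(j < n) Gamma S a i j z * W' t 0 j.
  by rewrite mulr_sumr; apply: eq_bigr => j _; rewrite mulrC -mulrA.
rewrite big_split /=.
move: (\sum_(j < n) Gamma S a i j z * W' t 0 j) => s1.
move: (\sum_(j < n) \sum_(k < n) _) => s2.
move: (\sum_(j < n) W t 0 j * 'D_(S a z) (Gamma S a i j) z) => s3.
move: (\sum_(j < n) _) (W'' t 0 i) => s4 s5; ring.
Qed.

End Jacobi.

(** * Sprays and projective changes *)

Section Homogeneity.
Variables (R : realType) (n : nat) (M : smooth_manifold R n).
Local Notation V := 'rV[R]_n.
Implicit Types (S : slit_field M) (P : slit_function M) (a b : atlas_index M) (z : V * V).

Lemma is_derive_ray (x y : V) (l : R) : is_derive l 1 (fun l : R => (x, l *: y)) (0, y).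
Proof.
apply: (@is_derive_pair _ _ _ (cst x)).

have -> : (fun l : R => l *: y) = (fun l : R => 0 + l *: y) by apply/funext => r; rewrite add0r.
exact: is_derive_line.
Qed.

(** The vertical component of [[Delta, S] = S] reads [df(0, xdot) - f = f]. *)
Lemma spray_euler S a i z : is_spray S -> slit a z ->
  'd (force S a i) z (0, z.2) = 2 * force S a i z.
Proof.
move=> [[[sS _] S1] brS] az.
have dS := smooth_on_differentiable (sS a) az.
have dL : differentiable (@liouville R n M a) z.
  apply: differentiable_pair; first exact: differentiable_cst.
  apply: (@linear_differentiable _ _ _ snd); move=> *; exact: cvg_snd.
have [_ lE] := differentiable_snd_coord i z.
have := congr1 (fun w : V * V => w.2 0 i) (brS a z az).
rewrite /lie_bracket /= mxE [X in _ + X]mxE -(diff_force i _ dS) -(diff_force i _ dL).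
have -> : force (@liouville R n M) a i = (fun z : V * V => z.2 0 i) by [].
rewrite (lE (S a z)) => /eqP; rewrite subr_eq => /eqP H; apply: etrans H _.
by rewrite mulr_natl mulr2n.
Qed.

(** By Euler's identity [f(x, r xdot) / r^2] has derivative zero for [r > 0]; its values at [l] and
    at 1 are therefore equal. *)
Lemma spray_homogeneous S a i z (l : R) : is_spray S -> slit a z -> 0 < l ->
  force S a i (z.1, l *: z.2) = l ^+ 2 * force S a i z.
Proof.
move=> spS az l0; have [[[sS _] S1] brS] := spS.
pose u (r : R) := force S a i (z.1, r *: z.2).
have du (r : R) : 0 < r -> is_derive r 1 u (r^-1 * (2 * u r)).
  move=> r0; have azr := slit_scale r0 az.
  have dS := smooth_on_differentiable (force_smooth i (sS a)) azr.
  have := is_derive_chain (is_derive_ray z.1 z.2 r) dS.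
  have -> // : 'd (force S a i) (z.1, r *: z.2) (0, z.2) = r^-1 * (2 * u r).
  rewrite -(spray_euler i spS azr) /=.
  have -> : (0, r *: z.2) = r *: (0, z.2) :> V * V.
    by congr (_, _); rewrite scaler0.
  rewrite linearZ; apply: esym; exact: (mulKf (lt0r_neq0 r0)).
pose w (r : R) := (r^-1 * r^-1) * u r.
have dw (r : R) : 0 < r -> is_derive r 1 w 0.
  move=> r0; have rn0 : r != 0 by rewrite gt_eqF.
  have dV : is_derive r 1 (fun r : R => r^-1) (- r ^- 2).
    have did : derivable (@id R) r 1 by exact: derivable_id.
    split; first exact: (derivableV rn0 did).
    by rewrite (deriveV rn0 did) derive_id [_ *: _]mulr1.
  apply: is_derive_val (is_derive_mul (is_derive_mul dV dV) (du r r0)).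
  field; exact: rn0.
have iA : is_interval [set r : R | 0 < r].
  by move=> x y /= x0 y0 r /andP[xr ry]; exact: lt_le_trans xr.
have := @is_derive0_cst _ _ w iA dw l 1 l0 ltr01.
rewrite /w /u invr1 !mul1r scale1r -surjective_pairing => <-.
by field; rewrite gt_eqF.
Qed.

(** Differentiate [f(x, l xdot) = l^2 f(x, xdot)] along the line through [z] with direction
    [(u, w)]; scaling the fibre turns this direction into [(u, l *: w)]. The point [z'] is a
    variable with an equation so that the velocity of a reparametrized geodesic can be inserted. *)
Lemma spray_diff_scale S a i z z' (l : R) (u w : V) : is_spray S -> slit a z -> 0 < l ->
  z' = (z.1, l *: z.2) ->
  'd (force S a i) z' (u, l *: w) = l ^+ 2 * 'd (force S a i) z (u, w).
Proof.
move=> spS az l0 ->; have [[[sS _] S1] brS] := spS.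
have dz := smooth_on_differentiable (force_smooth i (sS a)) az.
have dlz := smooth_on_differentiable (force_smooth i (sS a)) (slit_scale l0 az).
pose h (e : R) : V * V := (z.1 + e *: u, z.2 + e *: w).
pose hl (e : R) : V * V := (z.1 + e *: u, l *: z.2 + e *: (l *: w)).
have h0 : h 0 = z by rewrite /h !scale0r !addr0 -surjective_pairing.
have hl0 : hl 0 = (z.1, l *: z.2) by rewrite /hl !scale0r !addr0.
have dh (e : R) : is_derive e 1 h (u, w) by apply: is_derive_pair; exact: is_derive_line.
have dhl (e : R) : is_derive e 1 hl (u, l *: w) by apply: is_derive_pair; exact: is_derive_line.
have oA : open (h @^-1` slit a).
  apply: open_comp; last exact: open_slit.
  move=> e _; apply: differentiable_continuous; apply/derivable1_diffP.
  exact: (@ex_derive _ _ _ _ _ _ _ (dh e)).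
have D1 := is_derive_chain_at h0 (dh 0) dz.
have D3 : is_derive (0 : R) 1 (fun e => l ^+ 2 * force S a i (h e))
   (l ^+ 2 * 'd (force S a i) z (u, w)) by apply: is_deriveZ.
apply: is_derive_unique (is_derive_chain_at hl0 (dhl 0) dlz) _.
apply: is_derive_near D3; first exact: oA.
  by rewrite /= h0.
move=> e he; rewrite -(spray_homogeneous i spS he l0) /=.
by congr (force _ _ _ (_, _)); rewrite scalerDr !scalerA mulrC.
Qed.

Lemma hom1_euler P a z : smooth_slit_function P -> pos_homogeneous1 P ->
  slit a z -> 'd (P a) z (0, z.2) = P a z.
Proof.
move=> [sP _] hP az.
have dP := smooth_on_differentiable (sP a) az.
have E : z = (z.1, 1 *: z.2) by rewrite scale1r -surjective_pairing.
apply: is_derive_unique (is_derive_chain_at (esym E) (is_derive_ray z.1 z.2 1) dP) _.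
have D : is_derive (1 : R) 1 (fun l => l * P a z) (P a z).
  have := is_derive_mul (is_derive_id (1 : R) 1) (is_derive_cst (P a z) (1 : R) 1).
  by apply: is_derive_val; rewrite mulr0 add0r mulr1.
apply: (@is_derive_near _ _ _ _ _ _ _ _ [set l : R | 0 < l] _ _ _ D).
- exact: open_gt.
- exact: ltr01.
by move=> l l0; rewrite (hP a z l az l0).
Qed.

Lemma force_projective_change S P a i z :
  force (projective_change S P) a i z = force S a i z - 2 * (P a z * z.2 0 i).
Proof. by rewrite /force /projective_change /= !mxE mulrA. Qed.

Lemma is_derive_force_projective_change S P a i z v :
  is_spray S -> smooth_slit_function P -> slit a z ->
  is_derive z v (force (projective_change S P) a i)
    ('D_v (force S a i) z - 2 * (P a z * v.2 0 i + z.2 0 i * 'D_v (P a) z)).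
Proof.
move=> [[[sS _] S1] brS] [sP _] az.
have dS := smooth_on_differentiable (force_smooth i (sS a)) az.
have dP := smooth_on_differentiable (sP a) az.
have [dl lE] := differentiable_snd_coord i z.
have -> : force (projective_change S P) a i =
   (fun z => force S a i z - 2 * (P a z * z.2 0 i)).
  by apply/funext => y; rewrite force_projective_change.
have Dl := is_derive_diff v dl; rewrite lE in Dl.
have DP := derivableP (diff_derivable (v:=v) dP).
have DS := derivableP (diff_derivable (v:=v) dS).
exact: is_deriveB DS (is_deriveZ 2 (is_derive_mul DP Dl)).
Qed.

Lemma projective_change_C2 S P :
  is_spray S -> smooth_slit_function P -> C2_sode (projective_change S P).
Proof.
move=> spS sP'; have [[[sS _] S1] brS] := spS; have [sP _] := sP'.
split=> [a z az|a i]; first by rewrite /projective_change /= scaler0 subr0 S1.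
have dlz z := (differentiable_snd_coord i z).1.
split=> [z az|v z az].
  have -> : force (projective_change S P) a i =
     force S a i - (2 : R) *: (P a * (fun z : V * V => z.2 0 i)).
    by apply/funext => y; rewrite force_projective_change.
  apply: differentiableB.
    exact: smooth_on_differentiable (force_smooth i (sS a)) az.
  apply: differentiableZ; apply: differentiableM => //.
  exact: smooth_on_differentiable (sP a) az.
pose g := 'D_v (force S a i)
  - (2 : R) *: (v.2 0 i *: P a + (fun z : V * V => z.2 0 i) * 'D_v (P a)).
apply: (@differentiable_near _ _ _ g _ _ (slit a) (@open_slit _ _ _ a) az).
  move=> y ay; have [_ ->] := is_derive_force_projective_change i v spS sP' ay.
  by rewrite /g !fctE (mulrC (P a y)).
apply: differentiableB.
  exact: smooth_on_differentiable (smooth_on_derive v (force_smooth i (sS a))) az.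
apply: differentiableZ; apply: differentiableD.
  by apply: differentiableZ; exact: smooth_on_differentiable (sP a) az.
apply: differentiableM => //.
exact: smooth_on_differentiable (smooth_on_derive v (sP a)) az.
Qed.

End Homogeneity.

(** * Fields along a geodesic *)

Section Fields.
Variables (R : realType) (n : nat) (M : smooth_manifold R n).
Local Notation V := 'rV[R]_n.
Local Notation chi := (@atlas R n M).
Implicit Types (S : slit_field M) (P : slit_function M) (a b : atlas_index M) (z : V * V)
  (I : set R) (c : R -> M).

Lemma local_curve_transition c a b t : dom (chi a) (c t) ->
  local_curve c b t = transition (chi a) (chi b) (local_curve c a t).
Proof. by move=> at_; rewrite /transition /local_curve /= coordK. Qed.

Lemma local_curve_overlap I c a b t : in_chart I c a t -> in_chart I c b t ->
  overlap (chi a) (chi b) (local_curve c a t).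
Proof. by move=> [_ at_] [_ bt]; exists (c t). Qed.

Lemma velocity_ttransition S I c a b t : is_geodesic S I c ->
  in_chart I c a t -> in_chart I c b t ->
  velocity c b t = ttransition a b (velocity c a t).
Proof.
move=> gc at_ bt; have oA := geodesic_in_chart_open (a:=a) gc.
have [_ dx _ _] := geodesic_derive gc at_.
have Ut := local_curve_overlap at_ bt.
have dtau := smooth_on_differentiable (@atlas_smooth _ _ M a b) Ut.
rewrite /velocity /ttransition (local_curve_transition _ at_.2) /=; congr (_, _).
apply: is_derive1E; apply: (is_derive_near oA at_ _ (is_derive_chain dx dtau)).
by move=> s [_ as_]; rewrite (local_curve_transition b as_).
Qed.

(** The transformation law of [P] is differentiated along a line through the velocity with direction
    [(W, W')]. The tangent map sends this direction to its counterpart in the chart [b] because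
    second derivatives of the transition map are symmetric. *)
Lemma diff_slit_function_invariant S P I c W a b t :
  smooth_slit_function P -> is_geodesic S I c -> smooth_curve_field I c W ->
  in_chart I c a t -> in_chart I c b t ->
  'd (P b) (velocity c b t) (W b t, derive1 (W b) t) =
  'd (P a) (velocity c a t) (W a t, derive1 (W a) t).
Proof.
move=> [sP PE] gc [sW WE] at_ bt.
have oA := geodesic_in_chart_open (a:=a) gc.
have oB := geodesic_in_chart_open (a:=b) gc.
have oAB := openI oA oB.
have oU := @open_overlap _ _ M a b.
have stau := @atlas_smooth _ _ M a b.
set tau := transition (chi a) (chi b) in stau.
have [sa dx _ _] := geodesic_derive gc at_.
have [sb _ _ _] := geodesic_derive gc bt.
have Ut := local_curve_overlap at_ bt.
have vE := velocity_ttransition gc at_ bt.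
have dPa := smooth_on_differentiable (sP a) sa.
have dPb := smooth_on_differentiable (sP b) sb.
have dW := diffn_derivable ((smooth_onP _ oA).1 (sW a) 1%N) at_.
set x := local_curve c a t in Ut *; set z := velocity c a t in dx sa vE dPa *.
set w := W a t; set w' := derive1 (W a) t in dW *.
have Wb : W b t = 'd tau x w by exact: WE.
(* The chart change of [W'] carries a second derivative of [tau], taken first along the velocity and
   then along [w]; in [Dtau2] below the order is reversed. *)
have Wb' : derive1 (W b) t = 'd tau x w' + 'D_w ('D_(z.2) tau) x.
  apply: is_derive1E; apply: (@is_derive_near _ _ _ _ _ _ _ _ _ oAB (conj at_ bt)); last first.
    apply: (is_derive_tangent oU stau oAB (conj at_ bt)) dx dW.
    by move=> s [as_ bs]; exact: local_curve_overlap bs.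
  by move=> s [as_ bs]; rewrite (WE a b).
pose h (e : R) : V * V := (x + e *: w, z.2 + e *: w').
have h0 : h 0 = z by rewrite /h !scale0r !addr0.
have dx1 (e : R) : is_derive e 1 (fun e : R => x + e *: w) w by exact: is_derive_line.
have dy1 (e : R) : is_derive e 1 (fun e : R => z.2 + e *: w') w' by exact: is_derive_line.
have ox : open ((fun e : R => x + e *: w) @^-1` overlap (chi a) (chi b)).
  by apply: open_comp => // e _; exact: is_derive_continuous (dx1 e).
have oh : open (h @^-1` slit_overlap a b).
  apply: open_comp; last exact: open_slit_overlap.
  by move=> e _; exact: is_derive_continuous (is_derive_pair (dx1 e) (dy1 e)).
have D1 := is_derive_chain_at h0 (is_derive_pair (dx1 0) (dy1 0)) dPa.
have Dtau1 : is_derive (0 : R) 1 (fun e : R => tau (x + e *: w)) ('d tau x w).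
  apply: (is_derive_chain_at _ (dx1 0)); first by rewrite scale0r addr0.
  exact: smooth_on_differentiable Ut.
have Dtau2 : is_derive (0 : R) 1 (fun e : R => 'd tau (x + e *: w) (z.2 + e *: w'))
    ('d tau x w' + 'D_(z.2) ('D_w tau) x).
  have x0 : x + 0 *: w = x by rewrite scale0r addr0.
  have z0 : z.2 + 0 *: w' = z.2 by rewrite scale0r addr0.
  have := is_derive_tangent oU stau ox _ (fun s H => H) (dx1 0) (dy1 0).
  by rewrite x0 z0; apply; rewrite /= x0.
have D2 := is_derive_pair Dtau1 Dtau2.
have tt0 : (tau (x + 0 *: w), 'd tau (x + 0 *: w) (z.2 + 0 *: w')) = velocity c b t.
  have -> : x + 0 *: w = x by rewrite scale0r addr0.
  by rewrite scale0r addr0 vE.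
have D3 := is_derive_chain_at tt0 D2 dPb.
rewrite Wb Wb' -(schwarz_row _ _ oU stau Ut).
apply: is_derive_unique D3 _.
apply: (is_derive_near oh _ _ D1).
  by rewrite /= h0; split => //=; case: sa.
by move=> e he; rewrite -(PE a b _ he).
Qed.

(** The defect of [W] in the linearised geodesic equation. By [jacobi_operatorE] it is a component
    of the Jacobi operator; it is stated for curves in one chart so that the summands of a field can
    be treated separately. *)
Definition jacobi_residual S c a (W : R -> V) i t : R :=
  derive1 (derive1 W) t 0 i - 'd (force S a i) (velocity c a t) (W t, derive1 W t).

Lemma jacobi_residualD S c a (A : set R) W W' i t :
  open A -> A t -> diffn A 2 W -> diffn A 2 W' ->
  jacobi_residual S c a (fun s => W s + W' s) i t =
  jacobi_residual S c a W i t + jacobi_residual S c a W' i t.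
Proof.
move=> oA At DW DW'.
have dD s : A s -> is_derive s 1 (fun s => W s + W' s) (derive1 W s + derive1 W' s).
  by move=> As; exact: is_deriveD (diffn_derivable DW As) (diffn_derivable DW' As).
have dDD : is_derive t 1 (derive1 (fun s => W s + W' s))
    (derive1 (derive1 W) t + derive1 (derive1 W') t).
  have := is_deriveD (diffn_derivable (diffn_derive1P DW) At)
    (diffn_derivable (diffn_derive1P DW') At).
  exact: is_derive_derive1 oA At dD.
rewrite /jacobi_residual (is_derive1E dDD) (is_derive1E (dD t At)) mxE.
have LD : 'd (force S a i) (velocity c a t) (W t + W' t, derive1 W t + derive1 W' t) =
    'd (force S a i) (velocity c a t) (W t, derive1 W t) +
    'd (force S a i) (velocity c a t) (W' t, derive1 W' t).
  exact: (linearD ('d (force S a i) (velocity c a t))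
    (W t, derive1 W t) (W' t, derive1 W' t)).
by rewrite LD opprD addrACA.
Qed.

(** The velocity itself solves the linearised equation, so only derivatives of [k] survive, and
    Euler's identity cancels the terms in [k']. That identity is a hypothesis so that both [S] and
    [S - 2 P Delta] are covered. *)
Lemma jacobi_residual_tangential S I c a (k : R -> R) i t :
  C2_sode S ->
  (forall z, slit a z -> 'd (force S a i) z (0, z.2) = 2 * force S a i z) ->
  is_geodesic S I c -> in_chart I c a t -> diffn I 2 k ->
  jacobi_residual S c a (fun s => k s *: (velocity c a s).2) i t =
  derive1 (derive1 k) t * (velocity c a t).2 0 i.
Proof.
move=> [S1 S2] eu gc At Dk; have oA := geodesic_in_chart_open (a:=a) gc.
have [_ _ _] := gc.
pose y s := (velocity c a s).2.
pose y' s := (S a (velocity c a s)).2.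
have dy s : in_chart I c a s -> is_derive s 1 y (y' s).
  by move=> As; have [] := geodesic_derive gc As.
have dk s : in_chart I c a s -> is_derive s 1 k (derive1 k s).
  by move=> [Is _]; exact: diffn_derivable Dk Is.
have dk' s : in_chart I c a s -> is_derive s 1 (derive1 k) (derive1 (derive1 k) s).
  by move=> [Is _]; exact: (diffn_derivable (diffn_derive1P Dk) Is).
have [zs _ _ dv] := geodesic_derive gc At.
have dphi j : differentiable (force S a j) (velocity c a t) by exact: (S2 a j).1.
(* The geodesic equation differentiated once: [y'' = df(S)] along the velocity. *)
have dy' : is_derive t 1 y' (\row_j 'd (force S a j) (velocity c a t) (S a (velocity c a t))).
  by apply/is_derive_rowP => j; rewrite mxE; exact: (is_derive_chain dv (dphi j)).
have d1 s : in_chart I c a s ->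
    is_derive s 1 (fun s => k s *: y s) (derive1 k s *: y s + k s *: y' s).
  by move=> As; apply: is_derive_scale; auto.
have d2 := is_deriveD (is_derive_scale (dk' t At) (dy t At)) (is_derive_scale (dk t At) dy').
rewrite /jacobi_residual (is_derive1E (is_derive_derive1 oA At d1 d2)).
rewrite (is_derive1E (d1 t At)) !mxE.
have SE : S a (velocity c a t) = (y t, y' t) by rewrite [LHS]surjective_pairing (S1 a _ zs).
(* The pair splits as [k'] times the vertical vector [(0, y)], handled by Euler's identity, plus [k]
   times [S], whose contribution cancels [k y'']. *)
have LE : 'd (force S a i) (velocity c a t)
      (k t *: (velocity c a t).2, derive1 k t *: y t + k t *: y' t) =
    derive1 k t * (2 * y' t 0 i) +
    k t * 'd (force S a i) (velocity c a t) (S a (velocity c a t)).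
  have -> : (k t *: (velocity c a t).2, derive1 k t *: y t + k t *: y' t) =
     derive1 k t *: (0, (velocity c a t).2) + k t *: S a (velocity c a t) :> V * V.
    by rewrite SE; congr (_, _); rewrite /= scaler0 add0r.
  rewrite -[y' t 0 i]/(force S a i (velocity c a t)) -(eu _ zs).
  rewrite linearD; congr (_ + _); exact: linearZ.
rewrite LE /y; move: ('d _ _ _) (y' t 0 i) (_ 0 i) => u v w; ring.
Qed.

End Fields.

(** * Reparametrized Jacobi fields *)

Section Reparametrization.
Variables (R : realType) (n : nat) (M : smooth_manifold R n).
Local Notation V := 'rV[R]_n.
Implicit Types a : atlas_index M.

Lemma jacobi_fieldP (S : slit_field M) (I : set R) (c : R -> M) (J : curve_field M) :
  C2_sode S -> is_geodesic S I c -> smooth_curve_field I c J ->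
  is_jacobi_field S I c J <->
  (forall a i t, in_chart I c a t -> jacobi_residual S c a (J a) i t = 0).
Proof.
move=> CS gc sJ; have E a i t := jacobi_operatorE i CS gc (sJ.1 a) (t := t).
split=> [[_ H] a i t At|H].
  by rewrite /jacobi_residual -(E a i t At) H // mxE.
by split => // a t At; apply/rowP => i; rewrite (E a i t At) mxE; exact: H.
Qed.

Variables (S : slit_field M) (P : slit_function M).
Hypotheses (S_spray : is_spray S) (P_smooth : smooth_slit_function P).
Variables (I I' : set R) (c c' : R -> M) (theta : R -> R).
Hypotheses (c_geodesic : is_geodesic S I c)
  (theta_smooth : smooth_on I' theta) (thetaI : forall s, I' s -> I (theta s))
  (theta_increasing : forall s, I' s -> 0 < derive1 theta s)
  (c'E : forall s, I' s -> c' s = c (theta s))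
  (c'_geodesic : is_geodesic (projective_change S P) I' c').

Local Notation S' := (projective_change S P).

Lemma reparam_open : open I'.
Proof. by case: c'_geodesic => -[]. Qed.

Lemma reparam_in_chart a s : in_chart I' c' a s -> in_chart I c a (theta s).
Proof. by move=> [Is ds]; split; [exact: thetaI|rewrite -c'E]. Qed.

Lemma reparam_in_chart_open a : open (in_chart I' c' a).
Proof. exact: geodesic_in_chart_open c'_geodesic. Qed.

Lemma theta_diffn k : diffn I' k theta.
Proof. exact: ((smooth_onP _ reparam_open).1 theta_smooth). Qed.

Lemma theta_derive s : I' s -> is_derive s 1 theta (derive1 theta s).
Proof. exact: diffn_derivable (theta_diffn 1). Qed.

Lemma theta_derive2 s : I' s -> is_derive s 1 (derive1 theta) (derive1 (derive1 theta) s).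
Proof. exact: diffn_derivable (diffn_derive1P (theta_diffn 2)). Qed.

Lemma reparam_velocity a s : in_chart I' c' a s ->
  velocity c' a s = ((velocity c a (theta s)).1,
                     derive1 theta s *: (velocity c a (theta s)).2).
Proof.
move=> As; have Is := As.1.
have [_ dx _ _] := geodesic_derive c_geodesic (reparam_in_chart As).
rewrite /velocity /=; congr (_, _); first by rewrite /local_curve c'E.
apply: is_derive1E.
apply: (is_derive_near (@reparam_in_chart_open a) As _ (is_derive_comp (theta_derive Is) dx)).
by move=> r Ar; rewrite /local_curve c'E //; exact: Ar.1.
Qed.

(** The acceleration of [c'] is computed twice, from the geodesic equation of [S - 2 P Delta] and
    from the chain rule through [theta]. Homogeneity makes the terms [theta'^2 f] cancel, and what
    is left is an equation between multiples of the velocity. *)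
Lemma theta_second_derivative a s : in_chart I' c' a s ->
  derive1 (derive1 theta) s = - 2 * P a (velocity c' a s) * derive1 theta s.
Proof.
move=> As; have Is := As.1; have At := reparam_in_chart As.
have oA := @reparam_in_chart_open a.
have [zs _ dy _] := geodesic_derive c_geodesic At.
have [zs' _ dy' _] := geodesic_derive c'_geodesic As.
have E : is_derive s 1 (derive1 (local_curve c' a))
    (derive1 (derive1 theta) s *: (velocity c a (theta s)).2
     + derive1 theta s *: (derive1 theta s *: (S a (velocity c a (theta s))).2)).
  apply: (is_derive_near oA As _ (is_derive_scale (theta_derive2 Is)
    (is_derive_comp (theta_derive Is) dy))).
  by move=> r Ar; have [_ ->] := reparam_velocity Ar.
(* A geodesic is regular, so some component of the velocity is nonzero and can be cancelled at the
   end. *)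
have [i yi] : exists i, (velocity c a (theta s)).2 0 i != 0.
  by have [_ /rV0Pn] := zs.
have th0 := theta_increasing Is.
have := congr1 (fun w : V => w 0 i) (is_derive_unique dy' E).
rewrite -[LHS]/(force S' a i (velocity c' a s)) force_projective_change.
rewrite {1 3}(reparam_velocity As) (spray_homogeneous i S_spray zs th0) !mxE.
rewrite -/(force S a i (velocity c a (theta s))) /=.
move: (force S a i _) (P a _) (derive1 (derive1 theta) s) => f p t2 H.
apply: (mulIf yi); move: H; move: (derive1 theta s) (_ 0 i) => t1 y H; nra.
Qed.

(** With [K = J \o theta], the Jacobi equation and homogeneity cancel [theta'^2 J'']; the term
    [theta'' J'] equals [- 2 P K'] and cancels what comes from differentiating [xdot] in [2 P xdot].
    Only the derivative of [P] remains. *)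
Lemma reparam_residual a i s (J : curve_field M) :
  in_chart I' c' a s -> smooth_on (in_chart I c a) (J a) ->
  jacobi_residual S c a (J a) i (theta s) = 0 ->
  jacobi_residual S' c' a (J a \o theta) i s =
  2 * 'd (P a) (velocity c' a s) ((J a \o theta) s, derive1 (J a \o theta) s)
    * (velocity c' a s).2 0 i.
Proof.
move=> As sJ res0; have Is := As.1; have At := reparam_in_chart As.
have oA := @reparam_in_chart_open a.
have oB := geodesic_in_chart_open (a:=a) c_geodesic.
have [zs _ _ _] := geodesic_derive c_geodesic At.
have [zs' _ _ _] := geodesic_derive c'_geodesic As.
have DJ := (smooth_onP _ oB).1 sJ 2%N.
have d1 r : in_chart I' c' a r ->
    is_derive r 1 (J a \o theta) (derive1 theta r *: derive1 (J a) (theta r)).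
  move=> Ar; apply: is_derive_comp; first exact: theta_derive Ar.1.
  exact: diffn_derivable DJ (reparam_in_chart Ar).
have d2 := is_derive_derive1 oA As d1 (is_derive_scale (theta_derive2 Is)
  (is_derive_comp (theta_derive Is) (diffn_derivable (diffn_derive1P DJ) At))).
have th0 := theta_increasing Is.
have dS' := is_derive_force_projective_change i
  ((J a \o theta) s, derive1 (J a \o theta) s) S_spray P_smooth zs'.
have := (projective_change_C2 S_spray P_smooth).2 a i.
move=> [/(_ _ zs') dF _].
rewrite /jacobi_residual -(deriveE _ dF) (@derive_val _ _ _ _ _ _ _ dS').
have dFS := smooth_on_differentiable (force_smooth i (S_spray.1.1.1 a)) zs'.
have dFP := smooth_on_differentiable (P_smooth.1 a) zs'.
rewrite (deriveE _ dFS) (deriveE _ dFP) (is_derive1E d2) (is_derive1E (d1 _ As)).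
(* The Jacobi equation replaces [J''] by the differential of the force, which homogeneity moves from
   the velocity of [c] to that of [c']. *)
have SE : 'd (force S a i) (velocity c' a s)
    ((J a \o theta) s, derive1 theta s *: derive1 (J a) (theta s)) =
    derive1 theta s ^+ 2 * derive1 (derive1 (J a)) (theta s) 0 i.
  have -> := subr0_eq res0.
  exact: spray_diff_scale S_spray zs th0 (reparam_velocity As).
rewrite SE !mxE (theta_second_derivative As) /=.
move: ('d _ _ _) (P a _) => dp p.
move: (derive1 theta s) (derive1 (derive1 (J a)) (theta s) 0 i) => t1 j2.
move: (derive1 (J a) (theta s) 0 i) (_ 0 i) => j1 y; ring.
Qed.

End Reparametrization.

(** * Smooth functions and fields along a geodesic *)

Section CurveFields.
Variables (R : realType) (n : nat) (M : smooth_manifold R n).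
Local Notation V := 'rV[R]_n.
Implicit Types (S : slit_field M) (P : slit_function M) (a b : atlas_index M)
  (I : set R) (c : R -> M).

Lemma velocity_diffn S I c a k : is_geodesic S I c ->
  diffn (in_chart I c a) k (local_curve c a) /\
  diffn (in_chart I c a) k (fun s => (velocity c a s).2).
Proof.
move=> gc; have oA := geodesic_in_chart_open (a:=a) gc.
have [_ [_ [sc _]] _] := gc.
have Dk := (smooth_onP _ oA).1 (sc a) k.+1.
by split; [exact: diffnS|exact: diffn_derive1P].
Qed.

(** At each [t] the value is computed in some chart around [c t]; by invariance any other chart
    gives the same value, so on each chart domain smoothness can be read off from one local
    formula. *)
Lemma diff_slit_function_smooth S P I c W :
  smooth_slit_function P -> is_geodesic S I c -> smooth_curve_field I c W ->
  exists q : R -> R, (forall k, diffn I k q) /\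
    forall a t, in_chart I c a t ->
      q t = 'd (P a) (velocity c a t) (W a t, derive1 (W a) t).
Proof.
move=> sP gc sW.
pose q t := let a := sval (cid (atlas_cover (c t))) in
  'd (P a) (velocity c a t) (W a t, derive1 (W a) t).
have qE a t : in_chart I c a t ->
    q t = 'd (P a) (velocity c a t) (W a t, derive1 (W a) t).
  move=> At; apply: (diff_slit_function_invariant sP gc sW At).
  by split; [exact: At.1|exact: svalP (cid (atlas_cover (c t)))].
exists q; split => // k.
apply: (@diffn_cover _ _ _ (in_chart I c)).
  by move=> t It; have [a da] := atlas_cover (c t); exists a.
move=> a; have oA := geodesic_in_chart_open (a:=a) gc.
have [Dx Dy] := velocity_diffn a k gc.
have DW := (smooth_onP _ oA).1 (sW.1 a) k.+1.
have sl t : in_chart I c a t -> slit a (velocity c a t).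
  by move=> At; have [] := geodesic_derive gc At.
have DW' := diffn_derive1P DW.
have {}DW := diffnS DW.
apply: (@diffn_ext _ _ _ _ (fun t =>
   \sum_(j < n) W a t 0 j * 'D_(delta_mx 0 j, 0) (P a) (local_curve c a t, (velocity c a t).2)
 + \sum_(j < n) derive1 (W a) t 0 j *
     'D_(0, delta_mx 0 j) (P a) (local_curve c a t, (velocity c a t).2)) _ oA).
  move=> t At; rewrite (qE a t At) (linear_row_pair ('d (P a) (velocity c a t))).
  have dP := smooth_on_differentiable (sP.1 a) (sl t At).
  by congr (_ + _); apply: eq_bigr => j _; rewrite (deriveE _ dP).
have comp (F : V * V -> R) : smooth_on (slit a) F ->
    diffn (in_chart I c a) k (fun t => F (local_curve c a t, (velocity c a t).2)).
  move=> sF; apply: (@diffn_comp_pair _ _ _ _ _ F (local_curve c a)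
    (fun t => (velocity c a t).2) oA sF) => // t At; exact: sl.
apply: diffnD => //; apply: diffn_sum => // j; apply: diffnM => //.
- by move/(diffn_rowP _ _ oA) : DW.
- by apply: (comp ('D_(delta_mx 0 j, 0) (P a))); apply: smooth_on_derive; exact: sP.1.
- by move/(diffn_rowP _ _ oA) : DW'.
- by apply: (comp ('D_(0, delta_mx 0 j) (P a))); apply: smooth_on_derive; exact: sP.1.
Qed.

Lemma smooth_curve_field_tangential S I c W (k : R -> R) :
  is_geodesic S I c -> smooth_curve_field I c W -> (forall j, diffn I j k) ->
  smooth_curve_field I c (fun a t => W a t + k t *: (velocity c a t).2).
Proof.
move=> gc [sW WE] Dk; split=> [a|a b t At Bt].
  have oA := geodesic_in_chart_open (a:=a) gc.
  apply/(smooth_onP _ oA) => j; apply: diffnD => //.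
    exact: (smooth_onP _ oA).1 (sW a) j.
  apply: diffn_scale => //; last exact: (velocity_diffn a j gc).2.
  by apply: diffn_sub (Dk j) => s [].
rewrite (WE a b) // (velocity_ttransition gc At Bt) /=.
by rewrite linearD linearZ.
Qed.

Variables (I I' : set R) (c c' : R -> M) (theta : R -> R).

Lemma smooth_curve_field_comp S S' J : is_geodesic S I c -> is_geodesic S' I' c' ->
  smooth_on I' theta -> (forall s, I' s -> I (theta s)) ->
  (forall s, I' s -> c' s = c (theta s)) ->
  smooth_curve_field I c J ->
  smooth_curve_field I' c' (fun a => J a \o theta).
Proof.
move=> gc gc' sth thI c'E [sJ JE].
have H a s : in_chart I' c' a s -> in_chart I c a (theta s).
  by move=> [Is ds]; split; [exact: thI|rewrite -c'E].
have oI' : open I' by case: gc' => -[].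
split=> [a|a b t At Bt].
  have oA := geodesic_in_chart_open (a:=a) gc.
  have oA' := geodesic_in_chart_open (a:=a) gc'.
  apply/(smooth_onP _ oA') => k; apply/(diffn_rowP _ _ oA') => j.
  apply: (@diffn_comp _ _ (in_chart I c a) k theta (fun t => J a t 0 j) oA').
  - by move=> t /H.
  - by apply: (diffn_sub _ ((smooth_onP _ oI').1 sth k)) => s [].
  - by have /(diffn_rowP _ _ oA) := (smooth_onP _ oA).1 (sJ a) k; apply.
rewrite /= (JE a b); [|exact: H..].
by rewrite /local_curve c'E //; exact: At.1.
Qed.

End CurveFields.

(** * Tangential Jacobi fields *)

Section Tangential.
Variables (R : realType) (n : nat) (M : smooth_manifold R n).

(** For a tangential field the Jacobi equation is [k'' = 0], since the velocity never vanishes; an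
    affine function with two distinct zeros is zero. *)
Lemma tangential_jacobi_eq0 (S : slit_field M) (I : set R) (c : R -> M)
    (J : curve_field M) (k : R -> R) (t1 : R) :
  is_spray S -> is_geodesic S I c -> is_jacobi_field S I c J ->
  diffn I 2 k -> (forall a t, in_chart I c a t -> J a t = k t *: (velocity c a t).2) ->
  I 0 -> I t1 -> t1 != 0 -> k 0 = 0 -> k t1 = 0 ->
  forall t, I t -> k t = 0.
Proof.
move=> spS gc JJ Dk JE I0 It1 t10 k0 kt1.
have CS := sode_C2 spS.1.
have res := (jacobi_fieldP CS gc JJ.1).1 JJ.
have [[oI iI] _ _] := gc.
have k2 t : I t -> derive1 (derive1 k) t = 0.
  move=> It; have [a da] := atlas_cover (c t).
  have At : in_chart I c a t by [].
  have oA := geodesic_in_chart_open (a:=a) gc.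
  have [[_ /rV0Pn [i yi]] _ _ _] := geodesic_derive gc At.
  apply: (mulIf yi); rewrite mul0r.
  rewrite -(jacobi_residual_tangential CS (fun z => @spray_euler _ _ _ S a i z spS) gc At Dk).
  rewrite -(res a i t At) /jacobi_residual.
  (* [J] and [k] times the velocity agree on an open set of parameters, hence so do their first and
     second derivatives at [t]. *)
  have E s : in_chart I c a s -> k s *: (velocity c a s).2 = J a s by move=> As; rewrite JE.
  rewrite (E t At) (derive1_near oA At E).
  by rewrite (derive1_near oA At (fun s As => derive1_near oA As E)).
have k1 t : I t -> derive1 k t = derive1 k 0.
  move=> It; apply: (is_derive0_cst iI) => // s Is; rewrite -(k2 s Is).
  exact: diffn_derivable (diffn_derive1P Dk) Is.
have dl s : I s -> is_derive s 1 (fun s => k s - derive1 k 0 * s) 0.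
  move=> Is; have := is_deriveB (diffn_derivable Dk Is)
    (is_derive_mul (is_derive_cst (derive1 k 0) s 1) (is_derive_id s 1)).
  by apply: is_derive_val; rewrite k1 // mulr1 mulr0 addr0 subrr.
have klin t : I t -> k t = derive1 k 0 * t.
  move=> It; have := is_derive0_cst iI dl It I0.
  by rewrite k0 mulr0 subrr; exact: subr0_eq.
have c0 : derive1 k 0 = 0 by apply: (mulIf t10); rewrite mul0r -klin.
by move=> t It; rewrite klin // c0 mul0r.
Qed.

End Tangential.

(** * Conjugate points under a projective change *)

Theorem theorem1 (R : realType) (n : nat) (M : smooth_manifold R n)
    (S : slit_field M) (P : slit_function M)
    (S_spray : is_spray S)
    (P_smooth : smooth_slit_function P) (P_hom : pos_homogeneous1 P)
    (I I' : set R) (c c' : R -> M) (theta : R -> R)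
    (I0 : I 0) (c_geodesic : is_geodesic S I c)
    (I'0 : I' 0) (theta_diffeo : diffeomorphism I' I theta)
    (theta_increasing : forall s, I' s -> 0 < theta^`() s)
    (theta0 : theta 0 = 0)
    (c'E : forall s, I' s -> c' s = c (theta s))
    (c'_geodesic : is_geodesic (projective_change S P) I' c')
    (s1 : R) (I's1 : I' s1) (s1_neq0 : s1 != 0)
    (t1_conjugate : conjugate_at S I c (theta s1)) :
  conjugate_at (projective_change S P) I' c' s1.
Proof.
have [_ It1 t10 [J [JJ [t0 It0 J0] Jv0 Jv1]]] := t1_conjugate.
have [g [[thI gI' gK thK] [sth sg]]] := theta_diffeo.
have CS := sode_C2 S_spray.1.
have CS' := projective_change_C2 S_spray P_smooth.
have [[oI iI] _ _] := c_geodesic.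
have [[oI' iI'] _ _] := c'_geodesic.
have res := (jacobi_fieldP CS c_geodesic JJ.1).1 JJ.
have inA a s : in_chart I' c' a s -> in_chart I c a (theta s).
  exact: reparam_in_chart.
have Kf := smooth_curve_field_comp c_geodesic c'_geodesic sth thI c'E JJ.1.
have [q [Dq qE]] := diff_slit_function_smooth P_smooth c'_geodesic Kf.
(* The right-hand side is chosen to cancel the defect [2 q y] of [J \o theta], with [y] the velocity
   of [c']; the zeros of [k] at 0 and [s1] preserve the boundary values. *)
have [k [Dk k0 ks1 k2]] : exists k : R -> R, [/\ forall j, diffn I' j k, k 0 = 0, k s1 = 0 &
    forall t, I' t -> derive1 (derive1 k) t = - 2 * q t].
  apply: double_primitive => // j.
  exact: diffnM oI' (diffn_cst _ _ oI') (Dq j).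
pose J' : curve_field M := fun a s => (J a \o theta) s + k s *: (velocity c' a s).2.
have J'f := smooth_curve_field_tangential c'_geodesic Kf Dk.
split => //; exists J'; split.
- apply/(jacobi_fieldP CS' c'_geodesic J'f) => a i s As.
  have oA := geodesic_in_chart_open (a:=a) c'_geodesic.
  (* The force [f - 2 P xdot] is again homogeneous of degree 2, and its Euler identity follows from
     those of [f] and [P]. *)
  have eu z : slit a z -> 'd (force (projective_change S P) a i) z (0, z.2) =
      2 * force (projective_change S P) a i z.
    move=> az; rewrite -(deriveE _ ((CS'.2 a i).1 z az)).
    have [_ ->] := is_derive_force_projective_change i (0, z.2) S_spray P_smooth az.
    have dS := smooth_on_differentiable (force_smooth i (S_spray.1.1.1 a)) az.
    have dP := smooth_on_differentiable (P_smooth.1 a) az.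
    rewrite (deriveE _ dS) (deriveE _ dP) (spray_euler i S_spray az).
    rewrite (hom1_euler P_smooth P_hom az) force_projective_change /=; ring.
  rewrite (jacobi_residualD _ _ _ _ oA As); last 2 first.
  + exact: (smooth_onP _ oA).1 (Kf.1 a) 2%N.
  + apply: diffn_scale => //; last exact: (velocity_diffn a 2%N c'_geodesic).2.
    by apply: diffn_sub (Dk 2%N) => s' [].
  rewrite (reparam_residual S_spray P_smooth c_geodesic sth thI theta_increasing
    c'E c'_geodesic As (JJ.1.1 a) (res a i _ (inA a s As))).
  rewrite (jacobi_residual_tangential CS' eu c'_geodesic As (Dk 2%N)).
  by rewrite k2 ?(qE a s As); [ring|exact: As.1].
(* If [J'] vanished identically, [J \o theta] would be [- k] times the velocity of [c'], so that [J]
   would be tangential to [c]. *)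
- apply: contrapT => J'0.
  have J'v a s : in_chart I' c' a s -> J' a s = 0.
    move=> As; apply: contrapT => H; apply: J'0; exists s; first exact: As.1.
    by move=> v; apply: H; exact: v.
  (* The coefficient of [J] along [c], read at [g t] with [g] the inverse of [theta]; the factor
     [theta'] converts the velocity of [c'] into that of [c]. *)
  pose d t := - (k (g t) * derive1 theta (g t)).
  have g0 : g 0 = 0 by rewrite -{1}theta0 gK.
  have Dd : diffn I 2 d.
    have Dg := (smooth_onP _ oI).1 sg 2%N.
    have Dkg := diffn_comp oI gI' Dg (Dk 2%N).
    (* Order 3 for [theta] leaves order 2 for its derivative. *)
    have Dt := diffn_comp oI gI' Dg (diffn_derive1P ((smooth_onP _ oI').1 sth 3%N)).
    apply: (@diffn_ext _ _ I 2 _ d oI _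
      (diffnM oI (diffn_cst 2 (-1 : R) oI) (diffnM oI Dkg Dt))) => t _.
    by rewrite mulN1r.
  have Jd a t : in_chart I c a t -> J a t = d t *: (velocity c a t).2.
    move=> At; have It := At.1; have thg := thK t It.
    have As : in_chart I' c' a (g t).
      split; first exact: gI'.
      by rewrite c'E; [rewrite thg; exact: At.2|exact: gI'].
    have : J a t + k (g t) *: (velocity c' a (g t)).2 = 0.
      by rewrite -{1}thg; exact: J'v.
    move=> /eqP; rewrite addr_eq0 => /eqP ->.
    have -> := reparam_velocity c_geodesic sth thI c'E c'_geodesic As.
    by rewrite thg /d /= scaleNr scalerA.
  (* From [k], [d] inherits its zeros at 0 and [theta s1]; hence [d] vanishes, and [J] with it,
     against the choice of [t0]. *)
  apply: J0 => a At; rewrite (Jd a t0 At).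
  rewrite (tangential_jacobi_eq0 S_spray c_geodesic JJ Dd Jd I0 It1 t10) ?scale0r //.
  + by rewrite /d g0 k0 mul0r oppr0.
  + by rewrite /d gK // ks1 mul0r oppr0.
- move=> a As; rewrite /J' /= theta0 k0 scale0r addr0; apply: Jv0.
  by have := inA a 0 As; rewrite theta0.
- by move=> a As; rewrite /J' /= ks1 scale0r addr0; apply: Jv1; exact: inA.
Qed.
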